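(* There exist absolute constants $X,M>0$ (independent of $\chi_1,\chi_2,q_1,q_2$ and $w$) such that for all primitive quadratic Dirichlet characters $\chi_1$ modulo $q_1$ and $\chi_2$ modulo $q_2$, all real $w$ with $0<w<1$, and all real $x\ge X$, $$M\le \frac{1}{2\pi i}\int_{2-i\infty}^{2+i\infty} f(s+w)\,\frac{x^s}{s(s+1)(s+2)(s+3)(s+4)}\,\mathrm ds .$$
   Context: For primitive quadratic characters $\chi_1$ modulo $q_1>1$ and $\chi_2$ modulo $q_2>1$ (order $2$, real-valued, nonprincipal), define $$f(s)=\zeta(s)L(s,\chi_1)L(s,\chi_2)L(s,\chi_1\chi_2),$$ where $\zeta$ is the Riemann zeta function, $L(s,\cdot)$ denotes Dirichlet L-functions, and $\chi_1\chi_2$ is the pointwise product character modulo $q_1q_2$. The integral is along the vertical line $\operatorname{Re}s=2$. *)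

(* Defs.v *)
(* Stdlib reals with Coquelicot. *)
From Stdlib Require Import Reals ZArith Lra.
From Coquelicot Require Import Coquelicot.
Open Scope R_scope.

(** * Dirichlet characters, as functions on Z *)

(* [chi 1 = 1] follows from multiplicativity and [chi 1 <> 0]. *)
Definition dirichlet_character (q : Z) (chi : Z -> C) : Prop :=
  (0 < q)%Z /\
  (forall m n : Z, chi (m * n)%Z = Cmult (chi m) (chi n)) /\
  (forall n : Z, chi (n + q)%Z = chi n) /\
  (forall n : Z, chi n <> RtoC 0 <-> Z.gcd n q = 1%Z).

Definition principal (q : Z) (n : Z) : C :=
  if Z.eq_dec (Z.gcd n q) 1 then RtoC 1 else RtoC 0.

(* Not induced by a character of a smaller modulus. *)
Definition primitive_character (q : Z) (chi : Z -> C) : Prop :=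
  dirichlet_character q chi /\
  forall (d : Z) (psi : Z -> C),
    (d | q)%Z -> (0 < d < q)%Z -> dirichlet_character d psi ->
    ~ (forall n : Z, Z.gcd n q = 1%Z -> chi n = psi n).

(* [k] is the order of [chi] in the group of characters modulo [q]. *)
Definition character_order (q : Z) (chi : Z -> C) (k : nat) : Prop :=
  (0 < k)%nat /\
  (forall n : Z, Cpow (chi n) k = principal q n) /\
  (forall j : nat, (0 < j < k)%nat ->
     ~ (forall n : Z, Cpow (chi n) j = principal q n)).

(* Order 2; see [quadratic_real] and [quadratic_nonprincipal] below. *)
Definition quadratic_character (q : Z) (chi : Z -> C) : Prop :=
  dirichlet_character q chi /\ character_order q chi 2.

Lemma quadratic_real (q : Z) (chi : Z -> C) (n : Z) :
  quadratic_character q chi -> Im (chi n) = 0.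
Proof.
intros [_ [_ [H _]]]. specialize (H n).
unfold principal in H. simpl in H.
destruct (chi n) as [a b]; unfold Im; simpl.
destruct (Z.eq_dec (Z.gcd n q) 1); unfold Cmult, RtoC in H; simpl in H;
injection H as H1 H2;
(assert (H3 : a * b = 0) by lra);
(destruct (Rmult_integral _ _ H3) as [-> | ]; [nra | assumption]).
Qed.

Lemma quadratic_nonprincipal (q : Z) (chi : Z -> C) :
  quadratic_character q chi -> ~ (forall n : Z, chi n = principal q n).
Proof.
intros [_ [_ [_ H]]] E. apply (H 1%nat); [split; auto with arith|].
intros n. rewrite <- E. apply Cpow_1_r.
Qed.

Definition character_mul (chi1 chi2 : Z -> C) (n : Z) : C :=
  Cmult (chi1 n) (chi2 n).

(** * Complex exponential, powers and series *)

Definition Cexp (z : C) : C := (exp (Re z) * cos (Im z), exp (Re z) * sin (Im z)).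

(* [x ^ s] with the real logarithm, meaningful for [0 < x]. *)
Definition Rcpow (x : R) (s : C) : C := Cexp (Cmult s (RtoC (ln x))).

(* The sum of a complex series, total like [Series]; see [CSeries_unique]. *)
Definition CSeries (a : nat -> C) : C :=
  (Series (fun n => Re (a n)), Series (fun n => Im (a n))).

Lemma CSeries_unique (a : nat -> C) (l : C) :
  @is_series R_AbsRing C_R_NormedModule a l -> CSeries a = l.
Proof.
intros H.
assert (HR : forall n, sum_n (fun k => Re (a k)) n =
                       Re (@sum_n C_R_NormedModule a n)).
{ induction n as [|n IH]; [now rewrite !sum_O|].
  rewrite !sum_Sn, IH; reflexivity. }
assert (HI : forall n, sum_n (fun k => Im (a k)) n =
                       Im (@sum_n C_R_NormedModule a n)).
{ induction n as [|n IH]; [now rewrite !sum_O|].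
  rewrite !sum_Sn, IH; reflexivity. }
rewrite (surjective_pairing l). unfold CSeries. f_equal.
- apply is_series_unique. intros P [e He].
  assert (K := H (fun z => P (Re z))). destruct K as [N HN].
  + exists e. intros y [Hy _]. now apply He.
  + exists N. intros n Hn. rewrite HR. now apply HN.
- apply is_series_unique. intros P [e He].
  assert (K := H (fun z => P (Im z))). destruct K as [N HN].
  + exists e. intros y [_ Hy]. now apply He.
  + exists N. intros n Hn. rewrite HI. now apply HN.
Qed.

(** * L-functions *)

(* Given by their Dirichlet series, hence only meaningful on the half-plane
   [1 < Re s] of absolute convergence. The index [k] stands for [n = k + 1]. *)
Definition dirichlet_series (a : Z -> C) (s : C) : C :=
  CSeries (fun k => Cmult (a (Z.of_nat (S k))) (Rcpow (INR (S k)) (Copp s))).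

Definition zeta (s : C) : C := dirichlet_series (fun _ => RtoC 1) s.

Definition Lfun (chi : Z -> C) (s : C) : C := dirichlet_series chi s.

Definition fLchi (chi1 chi2 : Z -> C) (s : C) : C :=
  (zeta s * Lfun chi1 s * Lfun chi2 s * Lfun (character_mul chi1 chi2) s)%C.

(** * Integrals along vertical lines *)

(* [I] is the integral of [F] from [c - i oo] to [c + i oo] (upwards along
   [Re s = c]), with the two ends tending to infinity independently. *)
Definition is_vertical_integral (F : C -> C) (c : R) (I : C) : Prop :=
  exists J : C,
    @is_RInt_gen C_R_NormedModule (fun t : R => F (c, t))
      (Rbar_locally m_infty) (Rbar_locally p_infty) J /\
    I = Cmult Ci J.

(* Main.v *)
Require Import Defs.
From Stdlib Require Import Reals ZArith Lra Lia.
From Coquelicot Require Import Coquelicot.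
From HB Require Import structures.
From mathcomp Require Import all_boot.
Open Scope R_scope.

(** On the half-plane of absolute convergence [f] is the Dirichlet series
    [sum a(n) n^-s], where [a] is the Dirichlet convolution of [1], [chi1],
    [chi2] and [chi1 chi2]. Two facts give the theorem.

    Positivity: [a] is multiplicative, and at a prime power [p^k] it is the
    coefficient of [z^k] in
    [1 / ((1 - z) (1 - e1 z) (1 - e2 z) (1 - e1 e2 z))], where [e1] and [e2] in
    [{-1, 0, 1}] are the values of the characters at [p]. These coefficients
    are nonnegative ([local_coef_ge0]), so [a >= 0] ([lcoef_ge0]), and
    [a(1) = 1].

    Perron kernel: for real [u] the integral of [e^(su) / (s (s+1) ... (s+4))]
    over [Re s = 2] is [2 pi i] times the weight [(1 - e^-u)^4 / 24] if [u > 0]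
    and zero otherwise ([is_RInt_gen_kernel_re], [is_RInt_gen_kernel_im]). With
    [u = ln (x/n)] the integral of the theorem, divided by [2 pi i], is
    therefore the finite sum of [a(n) n^-w (1 - n/x)^4 / 24] over [n < x]. All
    its terms are nonnegative, and for [x >= 2] the term [n = 1] is at least
    [1/384].

    The kernel is computed without Cauchy's theorem. By partial fractions it is
    enough to know, for each pole, the limit of the truncated integral of
    [e^(su) / s] along [Re s = b]. By the Cauchy-Riemann equations its
    derivative with respect to [b] is a boundary term of size [e^(bu) / T].
    For [u < 0] let [b] tend to infinity: the integral is [O(1/T)]
    ([line_int_neg]). For [u > 0] note that the real part for [-u] on the line
    [b] is minus that for [u] on the line [-b]. Hence the integrals for [u] and
    [-u] add up to the jump across the pole, and letting [b] tend to [0] shows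
    that this is [pi] up to [O(1/T)] ([line_int_jump]).

    Sum and integral are exchanged by truncating each of the four L-series at
    [N]. The product of the truncations tends to [f] uniformly on the line
    ([fLchi_truncation]), and the kernel is dominated by [1 / (1 + t^2)].
    Regrouping the truncated product by [n = n1 n2 n3 n4] produces incomplete
    coefficients for large [n], but the weight vanishes for [n >= x], so the
    integral of the truncated product does not depend on [N >= x]
    ([wsum_ltrunc]). Hence the only sums ever rearranged are finite ones. *)

(** * Integrals of e^(su)/s along a truncated vertical line *)

(** [line_re] and [line_im] are the real and imaginary parts of [e^(su) / s] at
    [s = b + it]; [line_der] is the real part of its complex derivative. *)
Definition line_re (b u t : R) : R :=
  exp (b * u) * (b * cos (t * u) + t * sin (t * u)) / (b ^ 2 + t ^ 2).
Definition line_im (b u t : R) : R :=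
  exp (b * u) * (b * sin (t * u) - t * cos (t * u)) / (b ^ 2 + t ^ 2).
Definition line_der (b u t : R) : R :=
  exp (b * u) * (u * (b * cos (t * u) + t * sin (t * u)) / (b ^ 2 + t ^ 2) -
    ((b ^ 2 - t ^ 2) * cos (t * u) + 2 * b * t * sin (t * u)) / (b ^ 2 + t ^ 2) ^ 2).
(** The half-line [t >= 0] is enough, as [line_re] is even and [line_im] odd in [t]. *)
Definition line_int (T b u : R) : R := RInt (line_re b u) 0 T.

Lemma sqr_sum_pos (b t : R) : 0 < b -> 0 < b ^ 2 + t ^ 2.
Proof. move=> b0; nra. Qed.

Lemma is_derive_line_re (b u t : R) : 0 < b ->
  is_derive (fun b => line_re b u t) b (line_der b u t).
Proof.
move=> b0; have D := sqr_sum_pos b t b0.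
rewrite /line_re /line_der; auto_derive; first by simpl in D |- *; lra.
by field; simpl in D; nra.
Qed.

Lemma is_derive_line_im (b u t : R) : 0 < b ->
  is_derive (line_im b u) t (line_der b u t).
Proof.
move=> b0; have D := sqr_sum_pos b t b0.
rewrite /line_im /line_der; auto_derive; first by simpl in D |- *; lra.
by field; simpl in D; nra.
Qed.

Lemma continuity_2d_comp_cos (u x t : R) :
  continuity_2d_pt (fun _ t => cos (t * u)) x t.
Proof.
apply: (continuity_1d_2d_pt_comp cos (fun _ t => t * u)); first exact: continuity_cos.
apply: continuity_2d_pt_mult; [exact: continuity_2d_pt_id2|exact: continuity_2d_pt_const].
Qed.

Lemma continuity_2d_comp_sin (u x t : R) :
  continuity_2d_pt (fun _ t => sin (t * u)) x t.
Proof.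
apply: (continuity_1d_2d_pt_comp sin (fun _ t => t * u)); first exact: continuity_sin.
apply: continuity_2d_pt_mult; [exact: continuity_2d_pt_id2|exact: continuity_2d_pt_const].
Qed.

Lemma continuity_2d_line_der (u b t : R) : 0 < b ->
  continuity_2d_pt (fun b t => line_der b u t) b t.
Proof.
move=> b0; have D := sqr_sum_pos b t b0.
have c1 : continuity_2d_pt (fun b _ => b) b t by exact: continuity_2d_pt_id1.
have c2 : continuity_2d_pt (fun _ t => t) b t by exact: continuity_2d_pt_id2.
have cc := continuity_2d_comp_cos u b t.
have cs := continuity_2d_comp_sin u b t.
have ce : continuity_2d_pt (fun b _ => exp (b * u)) b t.
  apply: (continuity_1d_2d_pt_comp exp (fun b _ => b * u)).
    by apply: derivable_continuous_pt; apply: derivable_pt_exp.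
  by apply: continuity_2d_pt_mult => //; exact: continuity_2d_pt_const.
have k c := continuity_2d_pt_const b t c.
have cn : continuity_2d_pt (fun b t => b ^ 2 + t ^ 2) b t.
  by rewrite /=; repeat first [apply: continuity_2d_pt_plus | apply: continuity_2d_pt_mult] => //.
have ci : continuity_2d_pt (fun b t => / (b ^ 2 + t ^ 2)) b t.
  by apply: continuity_2d_pt_inv => //; lra.
have ci2 : continuity_2d_pt (fun b t => / (b ^ 2 + t ^ 2) ^ 2) b t.
  apply: continuity_2d_pt_inv; last by apply: pow_nonzero; lra.
  rewrite -[X in continuity_2d_pt X]/(fun b t => (b ^ 2 + t ^ 2) * ((b ^ 2 + t ^ 2) * 1)).
  by apply: continuity_2d_pt_mult => //; apply: continuity_2d_pt_mult.
rewrite /line_der /Rdiv; apply: continuity_2d_pt_mult => //.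
apply: continuity_2d_pt_minus; apply: continuity_2d_pt_mult => //.
  by repeat first [apply: continuity_2d_pt_plus | apply: continuity_2d_pt_mult] => //.
apply: continuity_2d_pt_plus; last by repeat apply: continuity_2d_pt_mult => //.
apply: continuity_2d_pt_mult => //; apply: continuity_2d_pt_minus => /=;
  by repeat apply: continuity_2d_pt_mult => //.
Qed.

Lemma continuous_line_re (b u t : R) : 0 < b -> continuous (line_re b u) t.
Proof.
move=> b0; have D := sqr_sum_pos b t b0.
apply: ex_derive_continuous; rewrite /line_re; auto_derive.
by simpl in D |- *; lra.
Qed.

Lemma ex_RInt_line_re (b u x y : R) : 0 < b -> ex_RInt (line_re b u) x y.
Proof. by move=> b0; apply: ex_RInt_continuous => t _; apply: continuous_line_re. Qed.

(** This is where holomorphy enters: by the Cauchy-Riemann equations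
    [line_der] is also the [t]-derivative of [line_im], so differentiating under
    the integral sign leaves the boundary term at [t = T], the one at [t = 0]
    being zero because [e^(bu) / b] is real. *)
Lemma is_derive_line_int (T b u : R) : 0 < b ->
  is_derive (fun b => line_int T b u) b (line_im b u T).
Proof.
move=> b0.
have near_b : locally b (fun y => 0 < y) by exact: open_gt.
have -> : line_im b u T = RInt (fun t => Derive (fun b => line_re b u t) b) 0 T.
  rewrite -[LHS](Rminus_0_r) -[X in _ - X](_ : line_im b u 0 = 0); last first.
    rewrite /line_im Rmult_0_l sin_0; field; lra.
  symmetry; apply: is_RInt_unique; apply: (is_RInt_derive (line_im b u)) => t _.
    by rewrite (is_derive_unique _ _ _ (is_derive_line_re b u t b0)); apply: is_derive_line_im.
  apply: (continuous_ext (fun t => line_der b u t)).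
    by move=> s; rewrite (is_derive_unique _ _ _ (is_derive_line_re b u s b0)).
  have D := sqr_sum_pos b t b0.
  apply: ex_derive_continuous; rewrite /line_der; auto_derive; simpl in D |- *.
  by repeat split; nra.
apply: (is_derive_RInt_param (fun b t => line_re b u t)).
- apply: filter_imp near_b => y y0 t _.
  by exists (line_der y u t); apply: is_derive_line_re.
- move=> t _; apply: (continuity_2d_pt_ext_loc (fun b t => line_der b u t)); last first.
    exact: continuity_2d_line_der.
  exists (mkposreal b b0) => x s /= Hx _.
  rewrite (is_derive_unique _ _ _ (is_derive_line_re x u s _)) //.
  by move: Hx; move/Rabs_def2; lra.
- by apply: filter_imp near_b => y y0; apply: ex_RInt_line_re.
Qed.

(** The mean value inequality with a bound that may vary along the interval. *)
Lemma increment_le (f g f' g' : R -> R) (a b : R) : a <= b ->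
  (forall x, a <= x <= b -> is_derive f x (f' x)) ->
  (forall x, a <= x <= b -> is_derive g x (g' x)) ->
  (forall x, a <= x <= b -> Rabs (f' x) <= g' x) ->
  Rabs (f b - f a) <= g b - g a.
Proof.
move=> ab df dg le.
have mono (e : R) : Rabs e = 1 -> e * (f b - f a) <= g b - g a.
  move=> he.
  have [c [Hc E]] : exists c, Rmin a b <= c <= Rmax a b /\
      (g b - e * f b) - (g a - e * f a) = (g' c - e * f' c) * (b - a).
    apply: (MVT_gen (fun x => g x - e * f x) a b (fun x => g' x - e * f' x)) => x Hx;
      rewrite Rmin_left // Rmax_right // in Hx.
      apply: is_derive_minus; first by apply: dg; lra.
      by apply: is_derive_scal; apply: df; lra.
    apply/continuity_pt_filterlim; apply: (ex_derive_continuous (fun x => g x - e * f x)).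
    exists (g' x - e * f' x); apply: is_derive_minus; first by apply: dg.
    by apply: is_derive_scal; apply: df.
  rewrite Rmin_left // Rmax_right // in Hc.
  have := le c Hc; have := Rle_abs (e * f' c); rewrite Rabs_mult he Rmult_1_l => h1 h2.
  nra.
have := mono 1 Rabs_R1; have := mono (-1) ltac:(by rewrite Rabs_Ropp Rabs_R1).
by move=> h1 h2; apply: Rabs_le; lra.
Qed.

Lemma Rabs_cos_le (x : R) : Rabs (cos x) <= 1.
Proof. by apply: Rabs_le; have := COS_bound x; lra. Qed.
Lemma Rabs_sin_le (x : R) : Rabs (sin x) <= 1.
Proof. by apply: Rabs_le; have := SIN_bound x; lra. Qed.

Lemma quotient_bound (b t x y : R) : 0 < b -> 0 <= t -> Rabs x <= 1 -> Rabs y <= 1 ->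
  Rabs ((b * x + t * y) / (b ^ 2 + t ^ 2)) <= (b + t) / (b ^ 2 + t ^ 2).
Proof.
move=> b0 t0 hx hy; have D := sqr_sum_pos b t b0.
rewrite Rabs_div; last lra. rewrite (Rabs_right (b ^ 2 + _)); last lra.
apply: Rmult_le_compat_r; first by left; apply: Rinv_0_lt_compat.
apply: Rle_trans (Rabs_triang _ _) _; rewrite !Rabs_mult (Rabs_right b) ?(Rabs_right t); try lra.
nra.
Qed.

Lemma line_im_bound (b u T : R) : 0 < b -> 0 < T ->
  Rabs (line_im b u T) <= 2 * exp (b * u) / T.
Proof.
move=> b0 T0; have D := sqr_sum_pos b T b0.
rewrite /line_im /Rdiv Rmult_assoc Rabs_mult (Rabs_right (exp _)); last by left; apply: exp_pos.
rewrite (Rmult_comm 2) Rmult_assoc; apply: Rmult_le_compat_l; first by left; apply: exp_pos.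
rewrite (_ : b * sin (T * u) - T * cos (T * u) = b * sin (T * u) + T * - cos (T * u)); last ring.
apply: Rle_trans (quotient_bound _ _ _ _ b0 _ (Rabs_sin_le _) _) _; first lra.
  by rewrite Rabs_Ropp; exact: Rabs_cos_le.
apply/Rle_div_l; first lra.
rewrite (_ : 2 * / T * (b ^ 2 + T ^ 2) = (2 * (b ^ 2 + T ^ 2)) / T); last by field; lra.
by apply/Rle_div_r => //; nra.
Qed.

Lemma le_of_le_plus_small (x y : R) (C : R) : (forall e, 0 < e < C -> x <= y + e) -> 0 < C -> x <= y.
Proof.
move=> H C0; apply: Rnot_lt_le => lt.
have := H (Rmin (C / 2) ((x - y) / 2)) _.
have m1 := Rmin_l (C / 2) ((x - y) / 2); have m2 := Rmin_r (C / 2) ((x - y) / 2).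
have m3 : 0 < Rmin (C / 2) ((x - y) / 2) by apply: Rmin_pos; lra.
by move=> /(_ ltac:(lra)); lra.
Qed.

Lemma is_derive_exp_scal (u k x : R) : u <> 0 ->
  is_derive (fun x => k / u * exp (x * u)) x (k * exp (x * u)).
Proof. by move=> u0; auto_derive => //; field. Qed.

(** A crude bound, not uniform in [T], whose only purpose is that it tends to
    zero as [b] grows, so that a line can be moved off to infinity. *)
Lemma line_int_far (T b u : R) : u < 0 -> 1 <= b -> 0 < T ->
  Rabs (line_int T b u) <= 2 * T / (b * (- u)).
Proof.
move=> u0 b1 T0; have b0 : 0 < b by lra.
rewrite /line_int.
have -> : 2 * T / (b * - u) = (T - 0) * (2 / (b * - u)) by field; lra.
have := @abs_RInt_le_const (line_re b u) 0 T (2 / (b * - u)) ltac:(lra) (ex_RInt_line_re b u 0 T b0).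
apply=> t Ht.
have D := sqr_sum_pos b t b0.
rewrite /line_re /Rdiv Rmult_assoc Rabs_mult (Rabs_right (exp _)); last by left; apply: exp_pos.
have e1 : exp (b * u) <= / (b * - u).
  rewrite (_ : b * u = - (b * - u)); last ring.
  rewrite exp_Ropp; apply: Rinv_le_contravar; first by nra.
  by have := exp_ineq1_le (b * - u); lra.
rewrite (Rmult_comm 2); apply: Rmult_le_compat => //; [by left; exact: exp_pos|exact: Rabs_pos|].
apply: Rle_trans (quotient_bound _ _ _ _ b0 _ (Rabs_cos_le _) (Rabs_sin_le _)) _; first lra.
apply/Rle_div_l; first lra.
by have := Rle_0_sqr (t - 1); have := Rle_0_sqr (b - 1); rewrite /Rsqr; nra.
Qed.

(** Moving the line from [b] to infinity costs at most the integral of the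
    boundary term, which converges because [u < 0]. *)
Lemma line_int_neg (T b u : R) : u < 0 -> 0 < b -> 0 < T ->
  Rabs (line_int T b u) <= 2 * exp (b * u) / (T * - u).
Proof.
move=> u0 b0 T0.
apply: (le_of_le_plus_small _ _ 1); last lra.
move=> e [e0 _].
pose B := Rmax (Rmax b 1) (2 * T / (e * - u)).
have B1 : Rmax b 1 <= B by exact: Rmax_l.
have B2 : 2 * T / (e * - u) <= B by exact: Rmax_r.
have bB : b <= B by apply: Rle_trans B1; exact: Rmax_l.
have oB : 1 <= B by apply: Rle_trans B1; exact: Rmax_r.
have far := line_int_far T B u u0 oB T0.
have eu : 0 < e * - u by nra.
have far2 : 2 * T / (B * - u) <= e.
  apply/Rle_div_l; first by nra.
  by move/(Rle_div_l _ _ _ eu): B2; nra.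
have := increment_le (fun x => line_int T x u) (fun x => (2 / T) / u * exp (x * u))
  (fun x => line_im x u T) (fun x => 2 / T * exp (x * u)) b B bB.
have -> : 2 * exp (b * u) / (T * - u) = - (2 / T / u * exp (b * u)) by field; lra.
have s : 2 / T / u * exp (B * u) <= 0.
  have : 0 < 2 / T * / - u by apply: Rmult_lt_0_compat; [apply: Rdiv_lt_0_compat; lra|apply: Rinv_0_lt_compat; lra].
  have -> : 2 / T / u = - (2 / T * / - u) by field; lra.
  by have := exp_pos (B * u); nra.
move=> H; have {}H := H _ _ _.
have : Rabs (line_int T B u - line_int T b u) <= 2 / T / u * exp (B * u) - 2 / T / u * exp (b * u).
  apply: H => x Hx.
  - by apply: is_derive_line_int; lra.
  - by apply: is_derive_exp_scal; lra.
  - by apply: Rle_trans (line_im_bound _ _ _ _ T0) _; [lra|right; rewrite /Rdiv; ring].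
have := Rabs_triang (line_int T b u - line_int T B u) (line_int T B u).
rewrite Rabs_minus_sym (_ : line_int T b u - line_int T B u + line_int T B u = line_int T b u); last ring.
lra.
Qed.

(** The case [u = 0], which also measures the jump across the pole. *)
Lemma RInt_poisson (b T : R) : 0 < b ->
  is_RInt (fun t => b / (b ^ 2 + t ^ 2)) 0 T (atan (T / b)).
Proof.
move=> b0; have -> : atan (T / b) = minus (atan (T / b)) (atan (0 / b)).
  by rewrite /Rdiv Rmult_0_l atan_0 /minus /plus /opp /=; ring.
apply: (is_RInt_derive (fun t => atan (t / b))) => t _; have D := sqr_sum_pos b t b0.
  by auto_derive => //; field; simpl in D |- *; split; nra.
apply: ex_derive_continuous; auto_derive; simpl in D |- *; lra.
Qed.

Lemma atan_large (x : R) : 0 < x -> Rabs (atan x - PI / 2) <= / x.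
Proof.
move=> x0; rewrite -{1}(Rinv_inv x) atan_inv; last exact: Rinv_0_lt_compat.
have xi : 0 < / x by exact: Rinv_0_lt_compat.
have a1 : 0 < atan (/ x) by rewrite -atan_0; exact: atan_increasing.
suff : atan (/ x) <= / x by move=> ?; apply: Rabs_le; lra.
have := increment_le atan (fun x => x) (fun x => / (1 + x ^ 2)) (fun _ => 1) 0 (/ x) (Rlt_le _ _ xi).
rewrite atan_0 !Rminus_0_r Rabs_right; last lra.
apply=> y _.
- by have := is_derive_atan y; rewrite /Rsqr /=; rewrite Rmult_1_r.
- exact: is_derive_id.
- have y2 := pow2_ge_0 y; rewrite Rabs_right; last by left; apply: Rinv_0_lt_compat; lra.
  by rewrite -[X in _ <= X]Rinv_1; apply: Rinv_le_contravar; lra.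
Qed.

Lemma Rabs_sin_le_Rabs (x : R) : Rabs (sin x) <= Rabs x.
Proof.
have pos y : 0 <= y -> Rabs (sin y) <= y.
  move=> y0; have := increment_le sin (fun x => x) cos (fun _ => 1) 0 y y0.
  rewrite sin_0 !Rminus_0_r.
  by apply=> z _; [exact: is_derive_sin|exact: is_derive_id|exact: Rabs_cos_le].
have [h|h] := Rle_lt_dec 0 x; first by rewrite (Rabs_right x); [exact: pos|lra].
by rewrite (Rabs_left x) // -Rabs_Ropp -sin_neg; apply: pos; lra.
Qed.

Lemma one_minus_cos_le (x : R) : 0 <= 1 - cos x <= x ^ 2 / 2.
Proof.
have -> : 1 - cos x = 2 * (sin (x / 2)) ^ 2.
  by rewrite {1}(_ : x = 2 * (x / 2)); [rewrite cos_2a_sin; ring|field].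
have : (sin (x / 2)) ^ 2 <= (x / 2) ^ 2.
  by rewrite -!Rsqr_pow2; apply: Rsqr_le_abs_1; exact: Rabs_sin_le_Rabs.
by have := pow2_ge_0 (sin (x / 2)); lra.
Qed.

Lemma exp_le_exp (x y : R) : x <= y -> exp x <= exp y.
Proof. by case=> [/exp_increasing|->]; lra. Qed.

Lemma exp_odd_part (x : R) : 0 <= x <= / 2 -> 0 <= exp x - exp (- x) <= 3 * x.
Proof.
move=> Hx; have h1 := exp_ineq1_le x; have h2 := exp_ineq1_le (- x).
have h3 : exp x <= 1 + 2 * x.
  rewrite -(Ropp_involutive x) exp_Ropp Ropp_involutive.
  apply: Rle_trans (Rinv_le_contravar (1 - x) _ _ _) _; try lra.
  by apply: (Rmult_le_reg_l (1 - x)); [lra|rewrite Rinv_r; nra].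
have h4 : exp (- x) <= 1 by rewrite -exp_0; apply: exp_le_exp; lra.
lra.
Qed.

Lemma exp_even_part (x : R) : 0 <= x <= / 2 -> 0 <= exp x + exp (- x) - 2 <= 3 * x ^ 2.
Proof.
move=> Hx; have [h1 h2] := exp_odd_part (x / 2) ltac:(lra).
have -> : exp x + exp (- x) - 2 = (exp (x / 2) - exp (- (x / 2))) ^ 2.
  have e1 : exp x = exp (x / 2) * exp (x / 2) by rewrite -exp_plus; congr exp; field.
  have e2 : exp (- x) = exp (- (x / 2)) * exp (- (x / 2)) by rewrite -exp_plus; congr exp; field.
  have e3 : exp (x / 2) * exp (- (x / 2)) = 1 by rewrite -exp_plus Rplus_opp_r exp_0.
  by rewrite e1 e2; lra.
nra.
Qed.

(** As [b] tends to [0] the two sides look like [2 b / (b^2 + t^2)], whose mass is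
    that of [pi] concentrated at [t = 0]. The odd part of [e^(bu)] is [O(b)] and
    comes with [t sin (tu) = O(t^2)], its even part minus [1] is [O(b^2)], and
    [cos (tu) - 1] is [O(t^2)]: after division by [b^2 + t^2] each error is
    [O(b)] uniformly in [t]. *)
Lemma near_pole (b u t : R) : 0 < b -> 0 <= u -> b * u <= / 2 ->
  Rabs (line_re b u t + line_re b (- u) t - 2 * (b / (b ^ 2 + t ^ 2))) <= 5 * b * u ^ 2.
Proof.
move=> b0 u0 bu; have D := sqr_sum_pos b t b0.
have bu0 : 0 <= b * u by apply: Rmult_le_pos; lra.
have [o0 o1] := exp_odd_part (b * u) (conj bu0 bu).
have [e0 e1] := exp_even_part (b * u) (conj bu0 bu).
have [c0 c1] := one_minus_cos_le (t * u).
have s1 : Rabs (t * sin (t * u)) <= t ^ 2 * u.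
  rewrite Rabs_mult; apply: Rle_trans (Rmult_le_compat_l _ _ _ (Rabs_pos _) (Rabs_sin_le_Rabs _)) _.
  by rewrite Rabs_mult -Rmult_assoc -Rabs_mult (Rabs_right u) ?(Rabs_right (t * t)); nra.
have cb := Rabs_cos_le (t * u).
rewrite /line_re !Ropp_mult_distr_r_reverse cos_neg sin_neg.
move: (exp (b * u)) (exp (- (b * u))) o0 o1 e0 e1 => p q o0 o1 e0 e1.
move: (cos (t * u)) (sin (t * u)) c0 c1 s1 cb => c s c0 c1 s1 cb.
have -> : p * (b * c + t * s) / (b ^ 2 + t ^ 2) + q * (b * c + t * - s) / (b ^ 2 + t ^ 2)
   - 2 * (b / (b ^ 2 + t ^ 2)) =
  (b * (p + q - 2) * c + (- (2 * b * (1 - c)) + (t * s) * (p - q))) / (b ^ 2 + t ^ 2) by field; lra.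
rewrite Rabs_div; last lra. rewrite (Rabs_right (b ^ 2 + _)); last lra.
apply/Rle_div_l => //.
have t1 : Rabs (b * (p + q - 2) * c) <= b * (3 * (b * u) ^ 2).
  rewrite !Rabs_mult (Rabs_right b) ?(Rabs_right (p + q - 2)); try lra.
  rewrite -[X in _ <= X]Rmult_1_r; apply: Rmult_le_compat => //; try exact: Rabs_pos; nra.
have t2 : Rabs (- (2 * b * (1 - c))) <= b * (t * u) ^ 2.
  by rewrite Rabs_Ropp Rabs_right; nra.
have t3 : Rabs (t * s * (p - q)) <= t ^ 2 * u * (3 * (b * u)).
  rewrite Rabs_mult (Rabs_right (p - q)); last lra.
  by apply: Rmult_le_compat => //; exact: Rabs_pos.
apply: Rle_trans (Rabs_triang _ _) _.
apply: Rle_trans (Rplus_le_compat _ _ _ _ t1 (Rle_trans _ _ _ (Rabs_triang _ _) (Rplus_le_compat _ _ _ _ t2 t3))) _.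
have : 0 <= b * u ^ 2 * (2 * b ^ 2 + t ^ 2) by apply: Rmult_le_pos; nra.
nra.
Qed.

Lemma line_int_near_pole (T b u : R) : 0 < T -> 0 < b -> 0 <= u -> b * u <= / 2 ->
  Rabs (line_int T b u + line_int T b (- u) - PI) <= 5 * b * u ^ 2 * T + 2 * (b / T).
Proof.
move=> T0 b0 u0 bu.
have i1 := RInt_correct _ _ _ (ex_RInt_line_re b u 0 T b0).
have i2 := RInt_correct _ _ _ (ex_RInt_line_re b (- u) 0 T b0).
have i3 := is_RInt_scal _ _ _ 2 _ (RInt_poisson b T b0).
have i4 := is_RInt_minus _ _ _ _ _ _ (is_RInt_plus _ _ _ _ _ _ i1 i2) i3.
have B : Rabs (line_int T b u + line_int T b (- u) - 2 * atan (T / b)) <= (T - 0) * (5 * b * u ^ 2).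
  have := norm_RInt_le_const _ 0 T _ (5 * b * u ^ 2) ltac:(lra) _ i4.
  by apply=> t _; exact: near_pole.
have tb : 0 < T / b by apply: Rdiv_lt_0_compat.
have := atan_large (T / b) tb; rewrite (_ : / (T / b) = b / T); last by field; lra.
move=> A.
have -> : line_int T b u + line_int T b (- u) - PI =
  (line_int T b u + line_int T b (- u) - 2 * atan (T / b)) + 2 * (atan (T / b) - PI / 2) by field.
apply: Rle_trans (Rabs_triang _ _) _; rewrite [Rabs (2 * _)]Rabs_mult (Rabs_right 2); last lra.
lra.
Qed.

(** Since [line_re b (- u) t = - line_re (- b) u t], this compares the lines [b]
    and [- b] on the two sides of the pole: the residue theorem for the upper half
    of the contour. *)
Lemma line_int_jump (T b u : R) : 0 < T -> 0 < b -> 0 < u ->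
  Rabs (line_int T b u + line_int T b (- u) - PI) <= 4 * exp (b * u) / T * b.
Proof.
move=> T0 b0 u0.
pose K := 5 * u ^ 2 * T + 2 / T.
have K0 : 0 < K.
  have : 0 < 2 / T by apply: Rdiv_lt_0_compat; lra.
  by rewrite /K; nra.
apply: (le_of_le_plus_small _ _ (K * Rmin b (/ (2 * u)))) => [e|]; last first.
  by apply: Rmult_lt_0_compat => //; apply: Rmin_pos => //; apply: Rinv_0_lt_compat; lra.
move=> [e0 e1].
pose y := e / K.
have y0 : 0 < y by apply: Rdiv_lt_0_compat.
have yK : y * K = e by rewrite /y; field; lra.
have ym : y < Rmin b (/ (2 * u)) by apply: (Rmult_lt_reg_r K) => //; rewrite yK; lra.
have yb : y <= b by have := Rmin_l b (/ (2 * u)); lra.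
have yu : y * u <= / 2.
  have h : y <= / (2 * u) by have := Rmin_r b (/ (2 * u)); lra.
  rewrite (_ : / 2 = / (2 * u) * u); last by field; lra.
  by apply: Rmult_le_compat_r; lra.
have near := line_int_near_pole T y u T0 y0 (Rlt_le _ _ u0) yu.
have {}near : Rabs (line_int T y u + line_int T y (- u) - PI) <= e.
  by apply: Rle_trans near _; right; rewrite -yK /K /Rdiv; ring.
have far := increment_le (fun x => line_int T x u + line_int T x (- u)) (fun x => 4 * exp (b * u) / T * x)
  (fun x => line_im x u T + line_im x (- u) T) (fun x => 4 * exp (b * u) / T) y b yb.
have {}far : Rabs (line_int T b u + line_int T b (- u) - (line_int T y u + line_int T y (- u)))
   <= 4 * exp (b * u) / T * b - 4 * exp (b * u) / T * y.
  apply: far => x Hx.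
  - by apply: (is_derive_plus (fun x => line_int T x u) (fun x => line_int T x (- u)));
      apply: is_derive_line_int; lra.
  - by auto_derive => //; ring.
  - apply: Rle_trans (Rabs_triang _ _) _.
    have x0 : 0 < x by lra.
    have h1 := line_im_bound x u T x0 T0; have h2 := line_im_bound x (- u) T x0 T0.
    have m1 : exp (x * u) <= exp (b * u) by apply: exp_le_exp; nra.
    have m2 : exp (x * - u) <= exp (b * u) by apply: exp_le_exp; nra.
    have Ti : 0 < / T by exact: Rinv_0_lt_compat.
    rewrite /Rdiv in h1 h2 *; nra.
have : 0 <= 4 * exp (b * u) / T * y.
  by apply: Rmult_le_pos; [apply: Rdiv_le_0_compat => //; have := exp_pos (b * u); lra|lra].
have := Rabs_triang (line_int T b u + line_int T b (- u) - (line_int T y u + line_int T y (- u)))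
  (line_int T y u + line_int T y (- u) - PI).
rewrite (_ : _ - (line_int T y u + line_int T y (- u)) + (line_int T y u + line_int T y (- u) - PI)
  = line_int T b u + line_int T b (- u) - PI); last ring.
lra.
Qed.

(** The value at [0] is the mean of the one-sided limits, as principal values
    require. *)
Definition heaviside (u : R) : R :=
  if Rlt_dec u 0 then 0 else if Rlt_dec 0 u then 1 else / 2.

Lemma line_int_heaviside (b u : R) : 0 < b ->
  exists K, forall T, 0 < T -> Rabs (line_int T b u - PI * heaviside u) <= K / T.
Proof.
move=> b0; rewrite /heaviside; case: Rlt_dec => /= [u0|u0].
  exists (2 * exp (b * u) / (- u)) => T T0; rewrite Rmult_0_r Rminus_0_r.
  by apply: Rle_trans (line_int_neg _ _ _ u0 b0 T0) _; right; field; lra.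
case: Rlt_dec => /= [up|un].
  exists (4 * exp (b * u) * b + 2 * exp (b * - u) / u) => T T0.
  have h1 := line_int_jump T b u T0 b0 up.
  have h2 := line_int_neg T b (- u) ltac:(lra) b0 T0.
  have -> : line_int T b u - PI * 1 = (line_int T b u + line_int T b (- u) - PI) - line_int T b (- u) by ring.
  apply: Rle_trans (Rabs_triang _ _) _; rewrite (Rabs_Ropp (line_int _ _ _)).
  apply: Rle_trans (Rplus_le_compat _ _ _ _ h1 h2) _.
  by rewrite Ropp_involutive; right; field; lra.
have E : u = 0 by lra.
exists b => T T0; rewrite E.
have -> : line_int T b 0 = atan (T / b).
  apply: is_RInt_unique; apply: (is_RInt_ext _ _ _ _ _ _ (RInt_poisson b T b0)) => t _.
  change (b / (b ^ 2 + t ^ 2) = line_re b 0 t :> R).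
  by rewrite /line_re !Rmult_0_r exp_0 cos_0 sin_0 /Rdiv; ring.
have tb : 0 < T / b by apply: Rdiv_lt_0_compat.
have := atan_large (T / b) tb; rewrite (_ : / (T / b) = b / T); last by field; lra.
by rewrite /Rdiv.
Qed.

(** * Improper integrals over the real line *)

Lemma is_RInt_gen_eps (f : R -> R) (l : R) :
  (forall a b, ex_RInt f a b) ->
  (forall e, 0 < e -> exists M, forall a b, a < - M -> M < b -> Rabs (RInt f a b - l) < e) ->
  is_RInt_gen f (Rbar_locally m_infty) (Rbar_locally p_infty) l.
Proof.
move=> ex H P [e He].
have [M HM] := H e (cond_pos e).
exists (fun a => a < - M) (fun b => M < b).
- by exists (- M).
- by exists M.
move=> a b Ha Hb /=; exists (RInt f a b); split; first exact: RInt_correct.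
by apply: He; apply: HM.
Qed.

Lemma is_RInt_gen_eps_inv (f : R -> R) (l : R) :
  is_RInt_gen f (Rbar_locally m_infty) (Rbar_locally p_infty) l ->
  forall e, 0 < e -> exists M, forall a b, a < - M -> M < b -> Rabs (RInt f a b - l) < e.
Proof.
move=> H e e0.
have [] := H (fun y => Rabs (y - l) < e); first by exists (mkposreal e e0).
move=> Q Q' [A HA] [B HB] HQ.
exists (Rmax (- A) B) => a b Ha Hb.
have h1 := Rmax_l (- A) B; have h2 := Rmax_r (- A) B.
have [y [/= Hy Py]] := HQ a b (HA a ltac:(lra)) (HB b ltac:(lra)).
by rewrite (is_RInt_unique _ _ _ _ Hy).
Qed.

Lemma RInt_reflect (f : R -> R) (e a b : R) :
  (forall x y, ex_RInt f x y) -> (forall t, f (- t) = e * f t) ->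
  RInt f a b = RInt f 0 b + e * RInt f 0 (- a).
Proof.
move=> ex He.
rewrite -(RInt_Chasles f a 0 b) // [plus _ _]Rplus_comm; congr (_ + _).
have H0 : is_RInt f (- 0) (- - a) (RInt f 0 a) by rewrite Ropp_0 Ropp_involutive; apply: RInt_correct.
have H1 := is_RInt_opp _ _ _ _ (is_RInt_comp_opp _ _ _ _ H0).
have H2 : is_RInt (fun t => scal e (f t)) 0 (- a) (opp (RInt f 0 a)).
  apply: is_RInt_ext H1 => t _; rewrite opp_opp He //.
have H3 := is_RInt_scal _ _ _ e _ (RInt_correct _ _ _ (ex 0 (- a))).
have E := eq_trans (esym (is_RInt_unique _ _ _ _ H2)) (is_RInt_unique _ _ _ _ H3).
by rewrite -(opp_RInt_swap f 0 a) // E.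
Qed.

(** For an even integrand the symmetric limit suffices although the two ends
    tend to infinity independently. *)
Lemma is_RInt_gen_even (f : R -> R) (l : R) :
  (forall x y, ex_RInt f x y) -> (forall t, f (- t) = f t) ->
  is_lim (fun T => RInt f 0 T) p_infty l ->
  is_RInt_gen f (Rbar_locally m_infty) (Rbar_locally p_infty) (2 * l).
Proof.
move=> ex ev /is_lim_spec L; apply: is_RInt_gen_eps => // e e0.
have [M HM] := L (pos_div_2 (mkposreal e e0)); rewrite /= in HM.
exists M => a b Ha Hb; rewrite (RInt_reflect f 1) //; last by move=> t; rewrite ev; ring.
have h1 := HM b Hb; have h2 := HM (- a) ltac:(lra).
rewrite (_ : _ - _ = (RInt f 0 b - l) + (RInt f 0 (- a) - l)); last ring.
by apply: Rle_lt_trans (Rabs_triang _ _) _; lra.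
Qed.

Lemma is_RInt_cauchy (K a b : R) :
  is_RInt (fun t => K / (1 + t ^ 2)) a b (K * (atan b - atan a)).
Proof.
have -> : K * (atan b - atan a) = minus (K * atan b) (K * atan a).
  by rewrite /minus /plus /opp /=; ring.
apply: (is_RInt_derive (fun t => K * atan t)) => t _; have D := pow2_ge_0 t; simpl in D.
  by auto_derive => //; rewrite /Rsqr; field; lra.
by apply: (ex_derive_continuous (fun t => K / (1 + t ^ 2))); auto_derive; lra.
Qed.

Lemma RInt_cauchy_bound (f : R -> R) (K a b : R) : a <= b -> ex_RInt f a b ->
  (forall t, Rabs (f t) <= K / (1 + t ^ 2)) ->
  Rabs (RInt f a b) <= K * (atan b - atan a).
Proof.
move=> ab ex H.
exact: (norm_RInt_le f (fun t => K / (1 + t ^ 2)) a b _ _ ab (fun t _ => H t)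
  (RInt_correct _ _ _ ex) (is_RInt_cauchy K a b)).
Qed.

(** By oddness the integral over [[a, b]] equals that over [[-a, b]], both ends of
    which are large and positive, so it is controlled by the tail of the
    dominating function. *)
Lemma is_RInt_gen_odd (f : R -> R) (K : R) :
  (forall x y, ex_RInt f x y) -> (forall t, f (- t) = - f t) ->
  (forall t, Rabs (f t) <= K / (1 + t ^ 2)) ->
  is_RInt_gen f (Rbar_locally m_infty) (Rbar_locally p_infty) 0.
Proof.
move=> ex od H; apply: is_RInt_gen_eps => // e e0.
have K0 : 0 <= K.
  have := Rle_trans _ _ _ (Rabs_pos _) (H 0); rewrite /= Rmult_0_l Rplus_0_r /Rdiv Rinv_1; lra.
exists ((K + 1) / e) => a b Ha Hb.
have Ke : 0 < (K + 1) / e by apply: Rdiv_lt_0_compat; lra.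
have E : RInt f a b = RInt f (- a) b.
  rewrite (RInt_reflect f (-1)) //; last by move=> t; rewrite od; ring.
  rewrite -(RInt_Chasles f (- a) 0 b) // -(opp_RInt_swap f (- a) 0) // /plus /opp /=; ring.
rewrite E Rminus_0_r.
have bd y : (K + 1) / e < y -> Rabs (atan y - PI / 2) <= e / (K + 1).
  move=> Hy; apply: Rle_trans (atan_large _ _) _; first lra.
  rewrite (_ : e / (K + 1) = / ((K + 1) / e)); last by field; lra.
  by apply: Rinv_le_contravar; lra.
have up y : atan y < PI / 2 by have := atan_bound y; lra.
have key : K * (e / (K + 1)) < e.
  by rewrite (_ : _ * _ = e - e / (K + 1)); [have : 0 < e / (K + 1) by apply: Rdiv_lt_0_compat; lra|field]; lra.
have b1 := bd b Hb; have b2 := bd (- a) ltac:(lra).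
have u1 := up b; have u2 := up (- a).
move/Rabs_le_between: b1 => b1; move/Rabs_le_between: b2 => b2.
have fin x y : x <= y -> Rabs (atan x - PI / 2) <= e / (K + 1) -> Rabs (RInt f x y) < e.
  move=> xy /Rabs_le_between h; apply: Rle_lt_trans (RInt_cauchy_bound _ _ _ _ xy (ex _ _) H) _.
  by apply: Rle_lt_trans key; apply: Rmult_le_compat_l => //; have := up y; lra.
have [le|lt] := Rle_lt_dec (- a) b; first by apply: fin => //; apply: bd; lra.
by rewrite -opp_RInt_swap // Rabs_Ropp; apply: fin; [lra|exact: bd].
Qed.

(** Exchange of limit and improper integral. The integrals of the approximations
    share one value [J], so only the integrands have to converge. *)
Lemma is_RInt_gen_dominated (F : R -> R) (Fn : nat -> R -> R) (eps : nat -> R) (J : R) (N0 : nat) :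
  (forall n a b, ex_RInt (Fn n) a b) ->
  (forall n t, Rabs (F t - Fn n t) <= eps n / (1 + t ^ 2)) ->
  is_lim_seq eps 0 ->
  (forall n, (N0 <= n)%nat ->
    is_RInt_gen (Fn n) (Rbar_locally m_infty) (Rbar_locally p_infty) J) ->
  is_RInt_gen F (Rbar_locally m_infty) (Rbar_locally p_infty) J.
Proof.
move=> ex H /is_lim_seq_spec L HJ.
have e0 n : 0 <= eps n.
  have := Rle_trans _ _ _ (Rabs_pos _) (H n 0); rewrite /= Rmult_0_l Rplus_0_r /Rdiv Rinv_1; lra.
have exF a b : ex_RInt F a b.
  have [] := filterlim_RInt Fn a b eventually _ F (fun n => RInt (Fn n) a b).
  - by move=> n; apply: RInt_correct.
  - move=> P [e He]; have [N HN] := L e.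
    exists N => n Hn; apply: He => t.
    have := HN n Hn; rewrite Rminus_0_r Rabs_right; last by have := e0 n; lra.
    move=> h; rewrite /ball /= /AbsRing_ball /abs /= /minus /plus /opp /=.
    rewrite -Rabs_Ropp Ropp_plus_distr Ropp_involutive Rplus_comm.
    apply: Rle_lt_trans (H n t) _; apply: Rle_lt_trans h.
    have := pow2_ge_0 t => t2; apply/Rle_div_l; first lra.
    by have := e0 n; nra.
  - by move=> I [_ HI]; exists I.
apply: is_RInt_gen_eps => // e ep.
(* The mass of [1 / (1 + t^2)] is [pi <= 4], hence the factor [8]. *)
have [N HN] := L (mkposreal (e / 8) ltac:(lra)).
pose n := (N + N0)%coq_nat.
have := HN n ltac:(rewrite /n; lia); rewrite /= Rminus_0_r Rabs_right; last by have := e0 n; lra.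
move=> en.
have [M HM] := is_RInt_gen_eps_inv _ _ (HJ n ltac:(apply/leP; rewrite /n; lia)) (e / 2) ltac:(lra).
exists (Rmax M 0) => a b Ha Hb.
have m1 := Rmax_l M 0; have m2 := Rmax_r M 0.
have {}HM := HM a b ltac:(lra) ltac:(lra).
have D := RInt_cauchy_bound (fun t => F t - Fn n t) (eps n) a b ltac:(lra)
  (ex_RInt_minus _ _ _ _ (exF a b) (ex n a b)) (H n).
rewrite (RInt_minus F (Fn n)) // in D; rewrite /minus /plus /opp /= in D.
have ab1 := atan_bound a; have ab2 := atan_bound b; have P4 := PI_4.
have D2 : eps n * (atan b - atan a) <= e / 8 * 4.
  apply: Rle_trans (Rmult_le_compat_l _ _ 4 (e0 n) _) _; first lra.
  by apply: Rmult_le_compat_r; lra.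
have := Rabs_triang (RInt F a b + - RInt (Fn n) a b) (RInt (Fn n) a b - J).
rewrite (_ : _ + _ + _ = RInt F a b - J); last ring.
lra.
Qed.

(** * The kernel of the integral *)

Definition kernel (u t : R) : C :=
  (Cexp ((2, t) * RtoC u) /
    ((2, t) * ((2, t) + 1) * ((2, t) + 2) * ((2, t) + 3) * ((2, t) + 4)))%C.

Lemma Cexp_div_line (k b u t : R) : 0 <= k -> b = 2 + k ->
  (Cexp ((2, t) * RtoC u) / ((2, t) + RtoC k))%C =
  (exp (- (k * u)) * line_re b u t, exp (- (k * u)) * line_im b u t).
Proof.
move=> k0 ->; have D := sqr_sum_pos (2 + k) t ltac:(lra).
have E : exp ((2 + k) * u) = exp (k * u) * exp (2 * u) by rewrite -exp_plus; congr exp; ring.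
have E2 : exp (- (k * u)) = / exp (k * u) by exact: exp_Ropp.
have p := exp_pos (k * u).
have D' : (2 + k) * ((2 + k) * 1) + (t + 0) * ((t + 0) * 1) <> 0 by simpl in D; lra.
apply: injective_projections; rewrite /line_re /line_im E E2
  /Cexp /Cdiv /Cmult /Cinv /RtoC /Cplus /Re /Im /=.
- rewrite !Rmult_0_r Rminus_0_r Rplus_0_l; field; lra.
- rewrite !Rmult_0_r Rminus_0_r Rplus_0_l; field; lra.
Qed.

Lemma Re_pos_neq_0 (z : C) : 0 < fst z -> z <> RtoC 0.
Proof. by move=> H E; rewrite E /= in H; lra. Qed.

Lemma kernel_partial_fractions (E s : C) : 0 < fst s ->
  (E / (s * (s + 1) * (s + 2) * (s + 3) * (s + 4)))%C =
  (RtoC (/ 24) * (E / (s + RtoC 0) - RtoC 4 * (E / (s + RtoC 1)) + RtoC 6 * (E / (s + RtoC 2))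
     - RtoC 4 * (E / (s + RtoC 3)) + E / (s + RtoC 4)))%C.
Proof.
move=> s0.
(* [field] over [C] recognizes only the constants built from [0] and [1]. *)
have e2 : RtoC 2 = (1 + 1)%C by rewrite -RtoC_plus.
have e3 : RtoC 3 = (1 + 1 + 1)%C by rewrite -!RtoC_plus; congr RtoC; ring.
have e4 : RtoC 4 = (1 + 1 + 1 + 1)%C by rewrite -!RtoC_plus; congr RtoC; ring.
have e6 : RtoC 6 = ((1 + 1) * (1 + 1 + 1))%C by rewrite -!RtoC_plus -RtoC_mult; congr RtoC; ring.
have e24 : RtoC (/ 24) = (/ ((1 + 1) * (1 + 1) * (1 + 1) * (1 + 1 + 1)))%C.
  by rewrite -!RtoC_plus -!RtoC_mult -RtoC_inv; [congr RtoC; field|lra].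
rewrite e24 e6 e4 e3 e2.
by field; do ?split; apply: Re_pos_neq_0 => /=; lra.
Qed.

(** Partial fractions: [1 / (s (s+1) ... (s+4))] has residue
    [(-1)^k binomial(4, k) / 24] at [s = -k], and [b = 2 + k] is the distance from
    that pole to the line [Re s = 2]. *)
Definition kernel_part (part : R -> R -> R -> R) (u t : R) : R :=
  / 24 * (part 2 u t - 4 * (exp (- u) * part 3 u t) + 6 * (exp (- (2 * u)) * part 4 u t)
    - 4 * (exp (- (3 * u)) * part 5 u t) + exp (- (4 * u)) * part 6 u t).

Lemma kernel_parts (u t : R) :
  kernel u t = (kernel_part line_re u t, kernel_part line_im u t).
Proof.
rewrite /kernel kernel_partial_fractions /=; last lra.
rewrite (Cexp_div_line 0 2) ?(Cexp_div_line 1 3) ?(Cexp_div_line 2 4) ?(Cexp_div_line 3 5)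
  ?(Cexp_div_line 4 6); try lra.
rewrite /kernel_part Rmult_0_l Ropp_0 exp_0 !Rmult_1_l.
by apply: injective_projections => /=; ring.
Qed.

Lemma ex_RInt_line_im (b u x y : R) : 0 < b -> ex_RInt (line_im b u) x y.
Proof.
move=> b0; apply: ex_RInt_continuous => t _; apply: ex_derive_continuous.
by exists (line_der b u t); exact: is_derive_line_im.
Qed.

Lemma ex_RInt_kernel_part (part : R -> R -> R -> R) (u x y : R) :
  (forall b, 0 < b -> ex_RInt (part b u) x y) -> ex_RInt (kernel_part part u) x y.
Proof.
move=> H; rewrite /kernel_part.
apply: (@ex_RInt_scal R_NormedModule); apply: (@ex_RInt_plus R_NormedModule).
  apply: (@ex_RInt_minus R_NormedModule); first apply: (@ex_RInt_plus R_NormedModule).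
  - apply: (@ex_RInt_minus R_NormedModule); first by apply: H; lra.
    by do 2!apply: (@ex_RInt_scal R_NormedModule); apply: H; lra.
  - by do 2!apply: (@ex_RInt_scal R_NormedModule); apply: H; lra.
  - by do 2!apply: (@ex_RInt_scal R_NormedModule); apply: H; lra.
by apply: (@ex_RInt_scal R_NormedModule); apply: H; lra.
Qed.

Lemma line_re_even (b u t : R) : line_re b u (- t) = line_re b u t.
Proof.
rewrite /line_re Ropp_mult_distr_l_reverse cos_neg sin_neg.
by congr (_ / _); ring.
Qed.

Lemma line_im_odd (b u t : R) : line_im b u (- t) = - line_im b u t.
Proof.
rewrite /line_im Ropp_mult_distr_l_reverse cos_neg sin_neg /Rdiv.
rewrite (_ : (- t) ^ 2 = t ^ 2); last ring.
ring.
Qed.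

Lemma Cmod_Cexp (z : C) : Cmod (Cexp z) = exp (fst z).
Proof.
rewrite /Cexp /Cmod /Re /Im /= -[RHS]sqrt_square; last by left; exact: exp_pos.
congr sqrt; have := sin2_cos2 (snd z); rewrite /Rsqr => h.
move: (exp _) (sin _) (cos _) h => E S K h.
transitivity (E * E * (S * S + K * K)); first ring.
by rewrite h Rmult_1_r.
Qed.

Lemma Cmod_ge (k t : R) : 0 <= k -> sqrt (1 + t ^ 2) <= Cmod ((2, t) + RtoC k)%C.
Proof. by move=> k0; rewrite /Cmod; apply: sqrt_le_1_alt => /=; nra. Qed.

Lemma Cmod_kernel (u t : R) : Cmod (kernel u t) <= exp (2 * u) / (1 + t ^ 2).
Proof.
have t2 := pow2_ge_0 t.
have s1 : 1 <= sqrt (1 + t ^ 2) by rewrite -{1}sqrt_1; apply: sqrt_le_1_alt; lra.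
have ss : sqrt (1 + t ^ 2) * sqrt (1 + t ^ 2) = 1 + t ^ 2 by apply: sqrt_sqrt; lra.
have g0 := Cmod_ge 0 t ltac:(lra); rewrite Cplus_0_r in g0.
have g1 := Cmod_ge 1 t ltac:(lra); have g2 := Cmod_ge 2 t ltac:(lra).
have g3 := Cmod_ge 3 t ltac:(lra); have g4 := Cmod_ge 4 t ltac:(lra).
rewrite /kernel Cmod_div; last first.
  by repeat apply: Cmult_neq_0; apply: Re_pos_neq_0 => /=; lra.
rewrite Cmod_Cexp !Cmod_mult /= Rmult_0_r Rminus_0_r.
apply: Rmult_le_compat_l; first by left; exact: exp_pos.
apply: Rinv_le_contravar; first lra.
rewrite -[1 + _ * _]/(1 + t ^ 2) -ss.
have m x y x' y' : 0 <= x -> 0 <= y -> x <= x' -> y <= y' -> 0 <= x * y /\ x * y <= x' * y'.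
  by move=> *; split; [exact: Rmult_le_pos|exact: Rmult_le_compat].
have [p1 q1] := m _ _ _ _ (ltac:(lra) : 0 <= sqrt (1 + t ^ 2)) (ltac:(lra) : 0 <= sqrt (1 + t ^ 2)) g0 g1.
have [p2 q2] := m _ 1 _ _ p1 ltac:(lra) q1 (Rle_trans _ _ _ s1 g2).
have [p3 q3] := m _ 1 _ _ p2 ltac:(lra) q2 (Rle_trans _ _ _ s1 g3).
have [_] := m _ 1 _ _ p3 ltac:(lra) q3 (Rle_trans _ _ _ s1 g4).
by rewrite !Rmult_1_r.
Qed.

(** The inverse Mellin transform of [1 / (s (s+1) ... (s+4))] at [e^u]. *)
Definition riesz_weight (u : R) : R := if Rlt_dec 0 u then (1 - exp (- u)) ^ 4 / 24 else 0.

(** The five terms are the binomial expansion of [(1 - e^-u)^4]; at [u = 0] it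
    vanishes, so the half value of [heaviside] there is harmless. *)
Lemma riesz_weight_heaviside (u : R) :
  riesz_weight u = / 24 * (heaviside u - 4 * (exp (- u) * heaviside u) + 6 * (exp (- (2 * u)) * heaviside u)
    - 4 * (exp (- (3 * u)) * heaviside u) + exp (- (4 * u)) * heaviside u).
Proof.
have -> : exp (- (2 * u)) = exp (- u) ^ 2.
  by rewrite /= Rmult_1_r -exp_plus; congr exp; ring.
have -> : exp (- (3 * u)) = exp (- u) ^ 3.
  by rewrite /= Rmult_1_r -!exp_plus; congr exp; ring.
have -> : exp (- (4 * u)) = exp (- u) ^ 4.
  by rewrite /= Rmult_1_r -!exp_plus; congr exp; ring.
rewrite /riesz_weight.
case: Rlt_dec => [u0|u0] /=.
  rewrite /heaviside; case: Rlt_dec => [|_] /=; first lra.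
  by case: Rlt_dec => [_|] /=; [field|lra].
rewrite /heaviside; case: Rlt_dec => [_|u1] /=; first ring.
case: Rlt_dec => [|_] //=.
have -> : u = 0 by lra.
rewrite Ropp_0 exp_0; field.
Qed.

Lemma is_lim_line_int (b u : R) : 0 < b ->
  is_lim (fun T => RInt (line_re b u) 0 T) p_infty (PI * heaviside u).
Proof.
move=> b0; have [K HK] := line_int_heaviside b u b0.
apply/is_lim_spec => e; exists (Rmax 0 (K / e)) => T HT.
have m1 := Rmax_l 0 (K / e); have m2 := Rmax_r 0 (K / e).
have T0 : 0 < T by lra.
apply: Rle_lt_trans (HK T T0) _.
have ep := cond_pos e.
apply/Rlt_div_l; first lra.
have : K / e < T by lra.
by move/Rlt_div_l => /(_ ep); lra.
Qed.

(** Each pole contributes only a conditionally convergent integral, known as a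
    symmetric limit; evenness of the sum upgrades it to independent ends. *)
Lemma is_RInt_gen_kernel_re (u : R) :
  is_RInt_gen (kernel_part line_re u) (Rbar_locally m_infty) (Rbar_locally p_infty) (2 * (PI * riesz_weight u)).
Proof.
apply: is_RInt_gen_even.
- by move=> x y; apply: ex_RInt_kernel_part => b b0; exact: ex_RInt_line_re.
- by move=> t; rewrite /kernel_part !line_re_even.
apply: (is_lim_ext (fun T => kernel_part (fun b u T => RInt (line_re b u) 0 T) u T)).
  move=> T; apply: esym; apply: is_RInt_unique; rewrite /kernel_part.
  have I b : 0 < b -> is_RInt (line_re b u) 0 T (RInt (line_re b u) 0 T).
    by move=> b0; apply: RInt_correct; exact: ex_RInt_line_re.
  apply: (@is_RInt_scal R_NormedModule); apply: (@is_RInt_plus R_NormedModule).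
    apply: (@is_RInt_minus R_NormedModule); first apply: (@is_RInt_plus R_NormedModule).
    - apply: (@is_RInt_minus R_NormedModule); first by apply: I; lra.
      by do 2!apply: (@is_RInt_scal R_NormedModule); apply: I; lra.
    - by do 2!apply: (@is_RInt_scal R_NormedModule); apply: I; lra.
    - by do 2!apply: (@is_RInt_scal R_NormedModule); apply: I; lra.
  by apply: (@is_RInt_scal R_NormedModule); apply: I; lra.
have L b : 0 < b -> is_lim (fun T => RInt (line_re b u) 0 T) p_infty (PI * heaviside u).
  exact: is_lim_line_int.
have LS (f : R -> R) (c l : R) : is_lim f p_infty l -> is_lim (fun T => c * f T) p_infty (c * l).
  by move=> H; apply: (is_lim_scal_l f c p_infty l).
rewrite riesz_weight_heaviside /kernel_part.
rewrite (_ : PI * _ = / 24 * (PI * heaviside u - 4 * (exp (- u) * (PI * heaviside u)) +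
  6 * (exp (- (2 * u)) * (PI * heaviside u))
    - 4 * (exp (- (3 * u)) * (PI * heaviside u)) + exp (- (4 * u)) * (PI * heaviside u))); last ring.
apply: (LS); apply: is_lim_plus'; last by apply: (LS); apply: (L); lra.
apply: is_lim_minus'; last by do 2!apply: (LS); apply: (L); lra.
apply: is_lim_plus'; last by do 2!apply: (LS); apply: (L); lra.
apply: is_lim_minus'; last by do 2!apply: (LS); apply: (L); lra.
by apply: (L); lra.
Qed.

Lemma Rabs_fst_le_Cmod (z : C) : Rabs (fst z) <= Cmod z.
Proof. exact: Rle_trans (Rmax_l _ _) (Rmax_Cmod z). Qed.
Lemma Rabs_snd_le_Cmod (z : C) : Rabs (snd z) <= Cmod z.
Proof. exact: Rle_trans (Rmax_r _ _) (Rmax_Cmod z). Qed.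

Lemma is_RInt_gen_kernel_im (u : R) :
  is_RInt_gen (kernel_part line_im u) (Rbar_locally m_infty) (Rbar_locally p_infty) 0.
Proof.
apply: (is_RInt_gen_odd _ (exp (2 * u))).
- by move=> x y; apply: ex_RInt_kernel_part => b b0; exact: ex_RInt_line_im.
- by move=> t; rewrite /kernel_part !line_im_odd; ring.
- by move=> t; apply: Rle_trans (Cmod_kernel u t); rewrite kernel_parts; exact: (Rabs_snd_le_Cmod (_, _)).
Qed.

(** * Dirichlet convolution and the coefficients of f *)

HB.instance Definition _ := Monoid.isComLaw.Build R 0 Rplus
  (fun x y z => esym (Rplus_assoc x y z)) Rplus_comm Rplus_0_l.
HB.instance Definition _ := Monoid.isMulLaw.Build R 0 Rmult Rmult_0_l Rmult_0_r.
HB.instance Definition _ := Monoid.isAddLaw.Build R Rmult Rplus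
  Rmult_plus_distr_r Rmult_plus_distr_l.

Notation "\sumR_ ( i <- s ) F" := (\big[Rplus/0]_(i <- s) F)
  (at level 41, F at level 41, i, s at level 50).

Definition conv (f g : nat -> R) (n : nat) : R :=
  \sumR_(d <- divisors n) (f d * g (n %/ d)%N).

Definition multiplicative (f : nat -> R) :=
  f 1%N = 1 /\
  forall m n : nat, (0 < m)%N -> (0 < n)%N -> coprime m n -> f (m * n)%N = f m * f n.

Lemma sumR_ge0 (I : Type) (s : seq I) (F : I -> R) :
  (forall i, 0 <= F i) -> 0 <= \sumR_(i <- s) F i.
Proof.
move=> H; elim: s => [|a s IH]; first by rewrite big_nil; lra.
rewrite big_cons; move: (H a); lra.
Qed.

Lemma sumR_pick (s : seq nat) (j : nat) (F : nat -> R) :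
  uniq s -> j \in s -> \big[Rplus/0]_(i <- s | i == j) F i = F j.
Proof. by move=> us js; rewrite -big_filter filter_pred1_uniq // big_seq1. Qed.

(** Regrouping a double sum by the value of the product. Products exceeding [N],
    for which the range of summation misses some factorizations, are killed by
    [phi]. *)
Lemma sum_conv (f g phi : nat -> R) (N : nat) :
  (forall m, (N < m)%N -> phi m = 0) ->
  \sumR_(i <- iota 1 N) (\sumR_(j <- iota 1 N) (f i * g j * phi (i * j)%N)) =
  \sumR_(n <- iota 1 N) (conv f g n * phi n).
Proof.
move=> Hphi.
transitivity (\sumR_(i <- iota 1 N) (\sumR_(j <- iota 1 N)
   (\big[Rplus/0]_(n <- iota 1 N | n == (i * j)%N) (f i * g j * phi n)))).
  apply: eq_big_seq => i Hi; apply: eq_big_seq => j Hj.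
  have [le|lt] := leqP (i * j)%N N.
    rewrite sumR_pick ?iota_uniq //.
    by move: Hi Hj; rewrite !mem_iota !add1n !ltnS => /andP[i0 _] /andP[j0 _]; rewrite le muln_gt0 i0 j0.
  rewrite Hphi // Rmult_0_r big_seq_cond big1 // => n /andP[Hn /eqP E].
  by move: Hn lt; rewrite mem_iota E add1n ltnS => /andP[_ /leq_gtF ->].
under eq_bigr => i _ do rewrite (exchange_big_dep xpredT) //=.
rewrite exchange_big /=; apply: eq_big_seq => n.
rewrite mem_iota add1n ltnS => /andP[n0 nN].
rewrite /conv big_distrl /=.
transitivity (\big[Rplus/0]_(i <- iota 1 N | (i %| n)%N) (f i * g (n %/ i)%N * phi n)).
  rewrite [RHS]big_mkcond /=; apply: eq_big_seq => i.
  rewrite mem_iota add1n ltnS => /andP[i0 iN].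
  case: ifP => [/dvdnP[k E]|Hn].
    have k0 : (0 < k)%N by case: k E n0 => // ->.
    rewrite E mulnK // -[RHS](@sumR_pick (iota 1 N) k (fun j => f i * g j * phi (k * i)%N)) ?iota_uniq //.
      by apply: eq_bigl => j; rewrite eq_sym mulnC eqn_pmul2r.
    by rewrite mem_iota add1n ltnS k0 (leq_trans _ nN) // E leq_pmulr.
  by apply: big1 => j /eqP E; move: Hn; rewrite E dvdn_mulr.
rewrite -big_filter; apply/perm_big/uniq_perm.
- by rewrite filter_uniq ?iota_uniq.
- exact: divisors_uniq.
move=> d; rewrite mem_filter -dvdn_divisors // mem_iota add1n ltnS.
case D: (d %| n)%N => //=.
by rewrite (dvdn_gt0 n0 D) (leq_trans (dvdn_leq n0 D) nN).
Qed.

(** For coprime [m] and [n] a divisor [k] of [m * n] is recovered from its two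
    factors [gcdn k m] and [gcdn k n]. *)
Lemma divisors_mul_coprime (m n : nat) : (0 < m)%N -> (0 < n)%N -> coprime m n ->
  perm_eq (divisors (m * n)) [seq (d * e)%N | d <- divisors m, e <- divisors n].
Proof.
move=> m0 n0 co.
have mn0 : (0 < m * n)%N by rewrite muln_gt0 m0.
have gl d e : (d %| m)%N -> (e %| n)%N -> gcdn (d * e) m = d.
  move=> dm en; rewrite gcdnC Gauss_gcdl; first by apply/gcdn_idPr.
  by rewrite (coprime_dvdr en).
have gr d e : (d %| m)%N -> (e %| n)%N -> gcdn (d * e) n = e.
  move=> dm en; rewrite gcdnC Gauss_gcdr; first by apply/gcdn_idPr.
  by rewrite coprime_sym (coprime_dvdl dm).
apply: uniq_perm; first exact: divisors_uniq.
  apply: allpairs_uniq; try exact: divisors_uniq.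
  move=> [d e] [d' e'] /allpairsP[[a b] [/= Ha Hb [-> ->]]] /allpairsP[[a' b'] [/= Ha' Hb' [-> ->]]] /= E.
  move: Ha Hb Ha' Hb'; rewrite -!dvdn_divisors // => Ha Hb Ha' Hb'.
  by rewrite -(gl a b) // -{2}(gr a b) // E gl // gr.
move=> k; rewrite -dvdn_divisors //; apply/idP/allpairsP => [km|[[d e] /= [Hd He ->]]].
  exists (gcdn k m, gcdn k n); rewrite -!dvdn_divisors // !dvdn_gcdr; split => //=.
  apply/eqP; rewrite eqn_dvd Gauss_dvd ?dvdn_gcdl ?andbT.
    by rewrite muln_gcdr !muln_gcdl !dvdn_gcd km dvdn_mulr // dvdn_mull // dvdn_mulr.
  exact: coprime_dvdl (dvdn_gcdr _ _) (coprime_dvdr (dvdn_gcdr _ _) co).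
by rewrite dvdn_mul // dvdn_divisors.
Qed.

Lemma conv_multiplicative (f g : nat -> R) :
  multiplicative f -> multiplicative g -> multiplicative (conv f g).
Proof.
move=> [f1 fM] [g1 gM]; split.
  by rewrite /conv (_ : divisors 1 = [:: 1%N]) // big_seq1 divn1 f1 g1; lra.
move=> m n m0 n0 co; rewrite /conv (perm_big _ (divisors_mul_coprime _ _ m0 n0 co)) /=.
rewrite big_allpairs_dep big_distrlr /=.
apply: eq_big_seq => d; rewrite -dvdn_divisors // => dm.
apply: eq_big_seq => e; rewrite -dvdn_divisors // => en.
have cde : coprime d e by rewrite (coprime_dvdl dm) // (coprime_dvdr en).
have cq : coprime (m %/ d) (n %/ e).
  by rewrite (coprime_dvdl (dvdn_div dm)) // (coprime_dvdr (dvdn_div en)).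
have d0 := dvdn_gt0 m0 dm; have e0 := dvdn_gt0 n0 en.
have -> : (m * n %/ (d * e) = (m %/ d) * (n %/ e))%N.
  by rewrite -{1}(divnK dm) -{1}(divnK en) mulnACA mulnK // muln_gt0 d0.
rewrite fM // gM ?divn_gt0 ?(dvdn_leq _ dm) ?(dvdn_leq _ en) //; ring.
Qed.

Lemma conv_pfactor (f g : nat -> R) (p k : nat) : prime p ->
  conv f g (p ^ k)%N = \sumR_(i <- iota 0 k.+1) (f (p ^ i)%N * g (p ^ (k - i))%N).
Proof.
move=> pp; have p0 := prime_gt0 pp; have p1 := prime_gt1 pp.
have P : perm_eq (divisors (p ^ k)) [seq (p ^ i)%N | i <- iota 0 k.+1].
  apply: uniq_perm; first exact: divisors_uniq.
    rewrite map_inj_in_uniq ?iota_uniq // => i j _ _ /eqP.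
    by rewrite eqn_exp2l // => /eqP.
  move=> d; rewrite -dvdn_divisors ?expn_gt0 ?p0 //.
  apply/(dvdn_pfactor _ _ pp)/mapP => [[i le ->]|[i]]; first by exists i; rewrite // mem_iota.
  by rewrite mem_iota => /= le ->; exists i.
rewrite /conv (perm_big _ P) big_map; apply: eq_big_seq => i.
by rewrite mem_iota /= add0n ltnS => ik; rewrite expnB.
Qed.

Lemma multiplicative_ge0 (h : nat -> R) : multiplicative h ->
  (forall p k, prime p -> 0 <= h (p ^ k)%N) ->
  forall n, (0 < n)%N -> 0 <= h n.
Proof.
move=> [h1 hM] hp; elim/ltn_ind => n IH n0.
have [n1|n1] := leqP n 1.
  have -> : n = 1%N by case: n n0 n1 {IH} => [|[]].
  by rewrite h1; lra.
have pp := pdiv_prime n1; set p := pdiv n in pp.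
rewrite -(partnC p n0) hM ?part_gt0 //; last first.
  exact: coprime_partC.
apply: Rmult_le_pos; first by rewrite p_part; apply: hp.
apply: IH; last exact: part_gt0.
rewrite -{2}(partnC p n0) ltn_Pmull ?part_gt0 // p_part.
by rewrite -(exp1n (logn p n)) ltn_exp2r ?prime_gt1 // logn_gt0 mem_primes pp n0 pdiv_dvd.
Qed.

(** What is used of a quadratic character restricted to the natural numbers. *)
Definition quadratic_signs (e : nat -> R) :=
  e 1%N = 1 /\ (forall m n : nat, e (m * n)%N = e m * e n) /\
  forall n : nat, e n = -1 \/ e n = 0 \/ e n = 1.

(** The four factors are paired so that, at a prime power, the second inner
    convolution is the first one twisted by [e2]. *)
Definition lcoef (e1 e2 : nat -> R) : nat -> R :=
  conv (conv (fun _ => 1) e1) (conv e2 (fun n => e1 n * e2 n)).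

Lemma completely_multiplicative (e : nat -> R) :
  e 1%N = 1 -> (forall m n : nat, e (m * n)%N = e m * e n) -> multiplicative e.
Proof. by move=> e1 eM; split=> // m n _ _ _; apply: eM. Qed.

Lemma completely_multiplicative_pow (e : nat -> R) (p k : nat) :
  e 1%N = 1 -> (forall m n : nat, e (m * n)%N = e m * e n) -> e (p ^ k)%N = e p ^ k.
Proof. by move=> e1 eM; elim: k => [|k IH] //; rewrite expnS eM IH. Qed.

Lemma sumR_iotaS (F : nat -> R) (k : nat) :
  \sumR_(i <- iota 0 k.+1) F i = (\sumR_(i <- iota 0 k) F i) + F k.
Proof. by rewrite -addn1 iotaD big_cat big_seq1. Qed.

Definition geom (z : R) (k : nat) : R := \sumR_(i <- iota 0 k.+1) (z ^ (k - i)).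

Lemma sumR_iota_shift (F G : nat -> R) (z : R) (k : nat) :
  \sumR_(i <- iota 0 k.+2) (F i * z ^ (k.+1 - i) * G (k.+1 - i)%N) =
  z * (\sumR_(i <- iota 0 k.+1) (F i * z ^ (k - i) * G (k - i).+1)) + F k.+1 * G 0%N.
Proof.
rewrite sumR_iotaS subnn pow_O Rmult_1_r; congr (_ + _).
rewrite big_distrr; apply: eq_big_seq => i.
by rewrite mem_iota ltnS => /= ik; rewrite subSn //=; ring.
Qed.

Lemma geomS (z : R) (k : nat) : geom z k.+1 = z * geom z k + 1.
Proof.
have H := sumR_iota_shift (fun _ => 1) (fun _ => 1) z k.
rewrite /geom -[X in _ = _ + X](Rmult_1_l 1) -[RHS](_ : z * (\sumR_(i <- iota 0 k.+1) (1 * z ^ (k - i) * 1)) + 1 * 1 = _).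
  by rewrite -H; apply: eq_bigr => i _; ring.
by congr (_ * _ + _); apply: eq_bigr => i _; ring.
Qed.

Lemma geom1 (k : nat) : geom 1 k = INR k + 1.
Proof.
elim: k => [|k IH]; first by rewrite /geom big_seq1 /=; ring.
by rewrite geomS IH S_INR; ring.
Qed.

Lemma geom0 (k : nat) : geom 0 k = 1.
Proof. by case: k => [|k]; [rewrite /geom big_seq1|rewrite geomS; ring]. Qed.

Lemma geomN1 (k : nat) : geom (-1) k = (1 + (-1) ^ k) / 2.
Proof.
elim: k => [|k IH]; first by rewrite /geom big_seq1 /=; field.
by rewrite geomS IH /=; field.
Qed.

(** The coefficients of [1 / (1 - z^2)^2], written as those of
    [1 / (1 - z)^2] times [1 / (1 + z)^2]. *)
Lemma alternating_product_sum (k : nat) :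
  \sumR_(i <- iota 0 k.+1) ((INR i + 1) * (-1) ^ (k - i) * (INR (k - i) + 1)) =
  (1 + (-1) ^ k) * (INR k + 2) / 4.
Proof.
pose b k := \sumR_(i <- iota 0 k.+1) ((INR i + 1) * (-1) ^ (k - i) * 1).
have Eb j : b j = (2 * INR j + 3 + (-1) ^ j) / 4.
  elim: j => [|j IH]; first by rewrite /b big_seq1 /=; field.
  rewrite /b (sumR_iota_shift (fun i => INR i + 1) (fun _ => 1)) -/(b j) IH S_INR /=.
  field.
elim: k => [|k IH]; first by rewrite big_seq1 /=; field.
rewrite (sumR_iota_shift (fun i => INR i + 1) (fun i => INR i + 1)).
have -> : \sumR_(i <- iota 0 k.+1) ((INR i + 1) * (-1) ^ (k - i) * (INR (k - i).+1 + 1))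
   = (1 + (-1) ^ k) * (INR k + 2) / 4 + b k.
  rewrite -IH -big_split; apply: eq_bigr => i _; rewrite S_INR /=; ring.
by rewrite Eb !S_INR /=; field.
Qed.

Lemma pow_N1_cases (k : nat) : (-1) ^ k = 1 \/ (-1) ^ k = -1.
Proof. by elim: k => [|k [] /= ->]; [left|right|left]; rewrite /=; ring. Qed.

(** Every summand is nonnegative, except when [z2 = -1] and [z1] is [0] or [1].
    Then the generating functions are [1 / (1 - z^2)] and [1 / (1 - z^2)^2], and
    the cancelling terms are summed in closed form. *)
Lemma local_coef_ge0 (z1 z2 : R) (k : nat) :
  z1 = -1 \/ z1 = 0 \/ z1 = 1 -> z2 = -1 \/ z2 = 0 \/ z2 = 1 ->
  0 <= \sumR_(i <- iota 0 k.+1) (geom z1 i * z2 ^ (k - i) * geom z1 (k - i)).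
Proof.
move=> H1 H2.
have g0 j : 0 <= geom z1 j.
  case: H1 => [|[]] ->; rewrite ?geomN1 ?geom0 ?geom1; first by case: (pow_N1_cases j) => ->; lra.
    lra.
  by move: (pos_INR j); lra.
have termwise : (forall j, 0 <= z2 ^ j * geom z1 j) ->
    0 <= \sumR_(i <- iota 0 k.+1) (geom z1 i * z2 ^ (k - i) * geom z1 (k - i)).
  by move=> H; apply: sumR_ge0 => i; rewrite Rmult_assoc; apply: Rmult_le_pos.
case: H2 termwise => [E2|[E2|E2]] termwise; subst z2.
- case: H1 g0 termwise => [E1|[E1|E1]] g0 termwise; subst z1.
  + by apply: termwise => j; rewrite geomN1; case: (pow_N1_cases j) => ->; lra.
  + rewrite (eq_bigr (fun i => (-1) ^ (k - i))) => [|i _]; last by rewrite !geom0; ring.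
    by rewrite -/(geom (-1) k) geomN1; case: (pow_N1_cases k) => ->; lra.
  + rewrite (eq_bigr (fun i => (INR i + 1) * (-1) ^ (k - i) * (INR (k - i) + 1))) => [|i _]; last by rewrite !geom1.
    rewrite alternating_product_sum; have := pos_INR k.
    by case: (pow_N1_cases k) => ->; lra.
- by apply: termwise => j; apply: Rmult_le_pos => //; apply: pow_le; lra.
- by apply: termwise => j; apply: Rmult_le_pos => //; apply: pow_le; lra.
Qed.

Lemma lcoef_multiplicative (e1 e2 : nat -> R) :
  quadratic_signs e1 -> quadratic_signs e2 -> multiplicative (lcoef e1 e2).
Proof.
move=> [a1 [aM _]] [b1 [bM _]].
apply: conv_multiplicative; apply: conv_multiplicative; apply: completely_multiplicative => // *.
- by rewrite Rmult_1_l.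
- by rewrite a1 b1 Rmult_1_l.
- by rewrite aM bM; ring.
Qed.

Lemma lcoef_ge0 (e1 e2 : nat -> R) :
  quadratic_signs e1 -> quadratic_signs e2 ->
  forall n, (0 < n)%N -> 0 <= lcoef e1 e2 n.
Proof.
move=> H1 H2; apply: multiplicative_ge0; first exact: lcoef_multiplicative.
move=> p k pp; case: H1 => a1 [aM av]; case: H2 => b1 [bM bv].
rewrite /lcoef conv_pfactor //.
have := local_coef_ge0 (e1 p) (e2 p) k (av p) (bv p).
congr (0 <= _); apply: eq_bigr => i _; rewrite Rmult_assoc; congr (_ * _).
  by rewrite conv_pfactor //; apply: eq_bigr => j _; rewrite completely_multiplicative_pow //; ring.
rewrite conv_pfactor // /geom big_distrr; apply: eq_big_seq => j.
rewrite mem_iota ltnS => /= jk.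
rewrite !(completely_multiplicative_pow e1) // !(completely_multiplicative_pow e2) //.
have -> : e2 p ^ (k - i) = e2 p ^ j * e2 p ^ (k - i - j) by rewrite -pow_add plusE subnKC.
rewrite /=; ring.
Qed.

(** * Dirichlet polynomials *)

(** A pair [(c, n)] in a list stands for the term [c n^-s]. Keeping the terms
    unsorted makes the product of two such sums a plain list of pairs, while
    [wsum phi] evaluates a linear functional with [n^-s] replaced by [phi n]. *)
Definition wsum (phi : nat -> R) (l : seq (R * nat)) : R :=
  \sumR_(p <- l) (p.1 * phi p.2).

Definition dmul (l1 l2 : seq (R * nat)) : seq (R * nat) :=
  [seq (p.1 * q.1, (p.2 * q.2)%N) | p <- l1, q <- l2].

Definition dtrunc (f : nat -> R) (N : nat) : seq (R * nat) :=
  [seq (f n, n) | n <- iota 1 N].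

Lemma wsum_dmul (phi : nat -> R) (l1 l2 : seq (R * nat)) :
  wsum phi (dmul l1 l2) = \sumR_(p <- l1) (p.1 * wsum (fun n => phi (p.2 * n)%N) l2).
Proof.
rewrite /wsum /dmul big_allpairs_dep /=; apply: eq_bigr => p _.
by rewrite big_distrr; apply: eq_bigr => q _ /=; ring.
Qed.

Lemma wsum_dmul_dtrunc (f g phi : nat -> R) (N : nat) :
  (forall m, (N < m)%N -> phi m = 0) ->
  wsum phi (dmul (dtrunc f N) (dtrunc g N)) = wsum phi (dtrunc (conv f g) N).
Proof.
move=> H; rewrite wsum_dmul /wsum /dtrunc !big_map /= -(sum_conv _ _ _ _ H).
by apply: eq_bigr => i _; rewrite big_map big_distrr; apply: eq_bigr => j _ /=; ring.
Qed.

Lemma eq_big_all (I : Type) (P : pred I) (s : seq I) (F G : I -> R) :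
  all P s -> (forall i, P i -> F i = G i) -> \sumR_(i <- s) F i = \sumR_(i <- s) G i.
Proof.
move=> Ps FG; elim: s Ps => [|i s IH] /=; first by rewrite !big_nil.
by case/andP=> Pi /IH E; rewrite !big_cons E FG.
Qed.

(** The weights vanishing above [N] are stable under replacing [phi] by
    [n |-> phi (k n)] with [k > 0], so the two factors can be changed in turn. *)
Lemma wsum_dmul_congr (phi : nat -> R) (l1 l1' l2 l2' : seq (R * nat)) (N : nat) :
  (forall m, (N < m)%N -> phi m = 0) ->
  (forall psi : nat -> R, (forall m, (N < m)%N -> psi m = 0) -> wsum psi l1 = wsum psi l1') ->
  (forall psi : nat -> R, (forall m, (N < m)%N -> psi m = 0) -> wsum psi l2 = wsum psi l2') ->
  all (fun p => 0 < p.2)%N l1 -> all (fun p => 0 < p.2)%N l2' ->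
  wsum phi (dmul l1 l2) = wsum phi (dmul l1' l2').
Proof.
move=> H H1 H2 P1 P2.
have zero m n : (N < m)%N -> (0 < n)%N -> (phi (m * n)%N = 0) * (phi (n * m)%N = 0).
  move=> Hm n0; split; apply: H; apply: leq_trans Hm _; [exact: leq_pmulr|exact: leq_pmull].
transitivity (wsum phi (dmul l1 l2')).
  rewrite !wsum_dmul; apply: (eq_big_all _ _ _ _ _ P1) => p p0; congr (_ * _).
  by apply: H2 => m Hm; exact: (zero _ _ Hm p0).2.
have sw l : wsum phi (dmul l l2') = \sumR_(q <- l2') (q.1 * wsum (fun n => phi (n * q.2)%N) l).
  rewrite wsum_dmul /wsum.
  under eq_bigr => p _ do rewrite big_distrr /=.
  rewrite exchange_big; apply: eq_bigr => q _; rewrite big_distrr.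
  by apply: eq_bigr => p _ /=; ring.
rewrite !sw; apply: (eq_big_all _ _ _ _ _ P2) => q q0; congr (_ * _).
by apply: H1 => m Hm; exact: (zero _ _ Hm q0).1.
Qed.

Lemma dtrunc_pos (f : nat -> R) (N : nat) : all (fun p => 0 < p.2)%N (dtrunc f N).
Proof. by rewrite all_map; apply/allP => n; rewrite mem_iota => /andP[]. Qed.

Lemma dmul_pos (l1 l2 : seq (R * nat)) :
  all (fun p => 0 < p.2)%N l1 -> all (fun p => 0 < p.2)%N l2 ->
  all (fun p => 0 < p.2)%N (dmul l1 l2).
Proof.
move=> P1 P2; elim: l1 P1 => //= p l1 IH /andP[p0 /IH P1].
rewrite /dmul allpairs_cons all_cat P1 andbT all_map.
by apply: sub_all P2 => q q0 /=; rewrite muln_gt0 p0.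
Qed.

Definition ltrunc (e1 e2 : nat -> R) (N : nat) : seq (R * nat) :=
  dmul (dmul (dtrunc (fun _ => 1) N) (dtrunc e1 N))
       (dmul (dtrunc e2 N) (dtrunc (fun n => e1 n * e2 n) N)).

(** The right-hand side is free of the truncation level [N']: this is what makes
    the integrals of all long truncations equal. *)
Lemma wsum_ltrunc (e1 e2 phi : nat -> R) (N N' : nat) :
  (forall m, (N < m)%N -> phi m = 0) -> (N <= N')%N ->
  wsum phi (ltrunc e1 e2 N') = wsum phi (dtrunc (lcoef e1 e2) N).
Proof.
move=> H le.
have H' m : (N' < m)%N -> phi m = 0 by move=> lt; apply: H; apply: leq_ltn_trans lt.
rewrite /ltrunc (wsum_dmul_congr _ _ (dtrunc (conv (fun _ => 1) e1) N') _
   (dtrunc (conv e2 (fun n => e1 n * e2 n)) N') N' H').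
- rewrite wsum_dmul_dtrunc // /wsum !big_map -(subnKC le) iotaD big_cat /=.
  rewrite [X in _ + X]big1_seq ?Rplus_0_r // => n; rewrite mem_iota add1n => /andP[_ /andP[lt _]].
  by rewrite H //; ring.
- by move=> psi Hpsi; apply: wsum_dmul_dtrunc.
- by move=> psi Hpsi; apply: wsum_dmul_dtrunc.
- by apply: dmul_pos; apply: dtrunc_pos.
- exact: dtrunc_pos.
Qed.

(** Positivity lets all terms but the one at [n = 1] be dropped. *)
Lemma wsum_lcoef_ge (e1 e2 phi : nat -> R) (N : nat) :
  quadratic_signs e1 -> quadratic_signs e2 -> (forall n, (0 < n)%N -> 0 <= phi n) -> (0 < N)%N ->
  phi 1%N <= wsum phi (dtrunc (lcoef e1 e2) N).
Proof.
move=> H1 H2 Hphi; case: N => // N _.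
rewrite /wsum big_map big_cons /= (proj1 (lcoef_multiplicative _ _ H1 H2)).
rewrite Rmult_1_l -[X in X <= _]Rplus_0_r; apply: Rplus_le_compat_l.
rewrite big_seq_cond; elim/big_rec: _ => [|n s /andP[]]; first lra.
rewrite mem_iota => /andP[n0 _] _ Hs.
have n0' : (0 < n)%N by exact: ltn_trans n0.
by have := Rmult_le_pos _ _ (lcoef_ge0 _ _ H1 H2 _ n0') (Hphi _ n0'); lra.
Qed.

(** * Uniform approximation of f by Dirichlet polynomials *)

Lemma telescoping_tail (c B : nat -> R) :
  (forall k, Rabs (c k) <= B k - B k.+1) -> is_lim_seq B 0 ->
  forall N m, Rabs (Series (fun k => c (m + k)%N) - \sumR_(i <- iota m N) c i) <= B (m + N)%N.
Proof.
move=> H L.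
have tele m : is_series (fun k => B (m + k)%N - B (m + k).+1) (B m).
  have L' : is_lim_seq (fun n => B m - B (m + n).+1) (B m - 0).
    apply: is_lim_seq_minus'; first exact: is_lim_seq_const.
    apply: (is_lim_seq_ext (fun n => B (n + m.+1)%coq_nat)).
      by move=> n; rewrite plusE addnS addnC.
    exact: (proj1 (is_lim_seq_incr_n B m.+1 0) L).
  rewrite Rminus_0_r in L'; apply: is_lim_seq_ext L' => n; elim: n => [|n IH].
    by rewrite sum_O addn0.
  by rewrite sum_Sn -IH /plus /= addnS; ring.
have bnd m k : Rabs (c (m + k)%N) <= B (m + k)%N - B (m + k).+1 by exact: H.
have ex m : ex_series (fun k => Rabs (c (m + k)%N)).
  apply: (ex_series_le _ (fun k => B (m + k)%N - B (m + k).+1)); last by exists (B m).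
  by move=> k; rewrite /norm /= /abs /= Rabs_Rabsolu; exact: bnd.
elim=> [|N IH] m.
  rewrite big_nil Rminus_0_r addn0.
  apply: Rle_trans (Series_Rabs _ (ex m)) _.
  rewrite -(is_series_unique _ _ (tele m)); apply: Series_le; last by exists (B m).
  by move=> k; split; [exact: Rabs_pos|exact: bnd].
rewrite /= big_cons Series_incr_1; last exact: ex_series_Rabs.
rewrite addn0 (Series_ext _ (fun k => c (m.+1 + k)%N)); last by move=> k; rewrite addnS.
have := IH m.+1; rewrite addSnnS.
by rewrite (_ : c m + _ - (c m + _) =
  Series (fun k => c (m.+1 + k)%N) - \sumR_(i <- iota m.+1 N) c i); last by ring.
Qed.

Definition dpoly (l : seq (R * nat)) (s : C) : C :=
  foldr (fun p z => (RtoC p.1 * Rcpow (INR p.2) (- s) + z)%C) (RtoC 0) l.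

Lemma Cexp_plus (a b : C) : Cexp (a + b)%C = (Cexp a * Cexp b)%C.
Proof.
rewrite /Cexp /Cmult /Re /Im /= exp_plus cos_plus sin_plus.
by apply: injective_projections => /=; ring.
Qed.

Lemma INR_pos (n : nat) : (0 < n)%N -> 0 < INR n.
Proof. by move/ltP => h; apply: lt_0_INR. Qed.

Lemma Rcpow_natM (m n : nat) (s : C) : (0 < m)%N -> (0 < n)%N ->
  Rcpow (INR (m * n)%N) s = (Rcpow (INR m) s * Rcpow (INR n) s)%C.
Proof.
move=> m0 n0; rewrite /Rcpow -Cexp_plus -multE mult_INR ln_mult; try exact: INR_pos.
by rewrite RtoC_plus Cmult_plus_distr_l.
Qed.

Lemma dpoly_cat (l1 l2 : seq (R * nat)) (s : C) :
  dpoly (l1 ++ l2) s = (dpoly l1 s + dpoly l2 s)%C.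
Proof.
elim: l1 => [|p l IH] /=; first by rewrite Cplus_0_l.
by rewrite IH Cplus_assoc.
Qed.

Lemma dpoly_dmul (l1 l2 : seq (R * nat)) (s : C) :
  all (fun p => 0 < p.2)%N l1 -> all (fun p => 0 < p.2)%N l2 ->
  dpoly (dmul l1 l2) s = (dpoly l1 s * dpoly l2 s)%C.
Proof.
move=> P1 P2; elim: l1 P1 => [|p l1 IH] /=; first by rewrite Cmult_0_l.
case/andP=> p0 P1; rewrite /dmul allpairs_cons dpoly_cat IH // Cmult_plus_distr_r.
congr (_ + _)%C; elim: l2 P2 {IH} => [|q l2 IH] /=; first by rewrite Cmult_0_r.
by case/andP=> q0 P2; rewrite IH // Rcpow_natM // RtoC_mult Cmult_plus_distr_l; ring.
Qed.

Lemma Cmod_Rcpow (n : nat) (s : C) : (0 < n)%N -> 2 <= fst s ->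
  Cmod (Rcpow (INR n) (- s)) <= / INR n ^ 2.
Proof.
move=> n0 s2; have i0 := INR_pos n n0.
rewrite /Rcpow Cmod_Cexp /=.
have l0 : 0 <= ln (INR n).
  by rewrite -ln_1; apply: ln_le; [lra|]; move/leP: n0 => /le_INR /=.
have -> : / (INR n * (INR n * 1)) = exp (- (2 * ln (INR n))).
  rewrite exp_Ropp (_ : 2 * ln (INR n) = ln (INR n) + ln (INR n)); last ring.
  by rewrite exp_plus exp_ln // Rmult_1_r.
by apply: exp_le_exp; nra.
Qed.

Lemma is_lim_seq_div_S (c : R) : is_lim_seq (fun k => c / (INR k + 1)) 0.
Proof.
apply: (is_lim_seq_ext (fun k => c * / INR k.+1)); first by move=> k; rewrite S_INR.
have L1 : is_lim_seq (fun k => / INR k.+1) 0.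
  apply: (proj1 (is_lim_seq_incr_1 (fun k => / INR k) 0)).
  exact: (is_lim_seq_inv _ _ is_lim_seq_INR).
by have := is_lim_seq_scal_l _ c _ L1; rewrite /= Rmult_0_r.
Qed.

(** The terms are bounded by [1/n^2], which the telescoping bound
    [2/n - 2/(n+1)] dominates; the real and imaginary parts each contribute
    [2 / (N + 1)]. *)
Lemma dirichlet_series_tail (chi : Z -> C) (a : nat -> R) (N : nat) (s : C) :
  (forall n, chi (Z.of_nat n) = RtoC (a n)) -> (forall n, Rabs (a n) <= 1) -> 2 <= fst s ->
  Cmod (dirichlet_series chi s - dpoly (dtrunc a N) s)%C <= 4 / (INR N + 1).
Proof.
move=> Hchi Ha s2.
pose term k := (chi (Z.of_nat k.+1) * Rcpow (INR k.+1) (- s))%C.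
pose B k := 2 / (INR k + 1).
have tb k : Cmod (term k) <= B k - B k.+1.
  rewrite /term Cmod_mult Hchi Cmod_R.
  have h1 := Cmod_Rcpow k.+1 s (ltn0Sn k) s2.
  apply: Rle_trans (Rmult_le_compat _ _ _ _ (Rabs_pos _) (Cmod_ge_0 _) (Ha _) h1) _.
  have k0 := pos_INR k; rewrite /B !S_INR Rmult_1_l.
  rewrite (_ : 2 / (INR k + 1) - 2 / (INR k + 1 + 1) = / ((INR k + 1) * (INR k + 1 + 1) / 2)).
    by apply: Rinv_le_contravar; nra.
  by field; lra.
have LB : is_lim_seq B 0 by exact: is_lim_seq_div_S.
have part (f : C -> R) : (forall z, Rabs (f z) <= Cmod z) -> f (RtoC 0) = 0 ->
    (forall x y, f (x + y)%C = f x + f y) ->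
    Rabs (Series (fun k => f (term k)) - f (dpoly (dtrunc a N) s)) <= B N.
  move=> fb f0 fD.
  have := telescoping_tail (fun k => f (term k)) B _ LB N 0.
  move/(_ (fun k => Rle_trans _ _ _ (fb _) (tb k))); rewrite add0n.
  congr (Rabs (_ - _) <= _).
  rewrite /dtrunc -[1%N]/(1 + 0)%N iotaDl -map_comp.
  elim: (iota 0 N) => [|k l IH]; first by rewrite big_nil f0.
  by rewrite big_cons IH /= fD /term Hchi add1n.
have h1 := part fst Rabs_fst_le_Cmod erefl (fun x y => erefl).
have h2 := part snd Rabs_snd_le_Cmod erefl (fun x y => erefl).
have E : (dirichlet_series chi s - dpoly (dtrunc a N) s)%C =
   (Series (fun k => fst (term k)) - fst (dpoly (dtrunc a N) s),
    Series (fun k => snd (term k)) - snd (dpoly (dtrunc a N) s)) by [].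
rewrite E; have := Cmod_triangle (RtoC (fst (dirichlet_series chi s - dpoly (dtrunc a N) s)%C))
  (Ci * RtoC (snd (dirichlet_series chi s - dpoly (dtrunc a N) s)%C))%C.
rewrite E Cmod_mult !Cmod_R Cmod_Ci Rmult_1_l.
rewrite (_ : (_ + Ci * _)%C = (Series (fun k => fst (term k)) - fst (dpoly (dtrunc a N) s),
    Series (fun k => snd (term k)) - snd (dpoly (dtrunc a N) s))); last first.
  by apply: injective_projections; rewrite /Cplus /Cmult /Ci /RtoC /=; ring.
move=> h3; apply: Rle_trans h3 _.
apply: Rle_trans (Rplus_le_compat _ _ _ _ h1 h2) _; rewrite /B; right; rewrite /Rdiv; ring.
Qed.

Lemma Cmod_mult_diff (a b a' b' : C) (x y z e : R) :
  Cmod a <= x -> Cmod b' <= y -> Cmod (a - a') <= z -> Cmod (b - b') <= e ->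
  Cmod (a * b - a' * b')%C <= x * e + z * y.
Proof.
move=> ha hb' ha' hb.
have -> : (a * b - a' * b' = a * (b - b') + (a - a') * b')%C by ring.
apply: Rle_trans (Cmod_triangle _ _) _; rewrite !Cmod_mult.
by apply: Rplus_le_compat; apply: Rmult_le_compat => //; exact: Cmod_ge_0.
Qed.

(** A quadratic character is real, and its square is principal, whence the
    values [-1], [0] and [1]. *)
Lemma quadratic_values (q : Z) (chi : Z -> C) :
  quadratic_character q chi ->
  (forall n : nat, chi (Z.of_nat n) = RtoC (Re (chi (Z.of_nat n)))) /\
  quadratic_signs (fun n => Re (chi (Z.of_nat n))).
Proof.
move=> H; have re z : chi z = RtoC (Re (chi z)).
  by have := quadratic_real q chi z H; rewrite /Re /Im /RtoC; case: (chi z) => a b /= ->.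
case: H => [[_ [HM [_ H1]]] [_ [H2 _]]]; split => //.
have reM m n : Re (chi (m * n)%Z) = Re (chi m) * Re (chi n).
  by rewrite HM [in LHS](re m) [in LHS](re n) /Cmult /RtoC /Re /=; ring.
split; last split.
- change (Re (chi 1%Z) = 1); have : chi 1%Z <> RtoC 0 by apply/H1; exact: Z.gcd_1_l.
  have := reM 1%Z 1%Z; rewrite Z.mul_1_l => h.
  rewrite re => nz; have {}nz : Re (chi 1%Z) <> 0 by move=> E; apply: nz; rewrite E.
  by apply: (Rmult_eq_reg_l (Re (chi 1%Z))) => //; rewrite -h Rmult_1_r.
- by move=> m n; rewrite -multE Nat2Z.inj_mul.
- move=> n; have := H2 (Z.of_nat n); rewrite /= Cmult_1_r re => /(congr1 fst).
  rewrite /principal; case: Z.eq_dec => _; rewrite /Cmult /RtoC /=; move: (Re _) => r h.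
    have : (r - 1) * (r + 1) = 0 by lra.
    by case/Rmult_integral => ?; [right; right|left]; lra.
  have : r * r = 0 by lra.
  by case/Rmult_integral => ?; right; left.
Qed.

Lemma quadratic_signs_bound (e : nat -> R) (n : nat) : quadratic_signs e -> Rabs (e n) <= 1.
Proof. by case=> _ [_ v]; apply: Rabs_le; case: (v n) => [|[]] ->; lra. Qed.

(** The truncation at [N = 0] is zero, so the tail estimate also bounds each
    series by [4] and hence each truncation by [8]. With [e = 4 / (N + 1)] a pair of
    factors errs by [12 e], and the product by
    [16 * 12 e + 12 e * 64 = 960 e]. *)
Lemma fLchi_truncation (chi1 chi2 : Z -> C) (e1 e2 : nat -> R) (N : nat) (s : C) :
  (forall n, chi1 (Z.of_nat n) = RtoC (e1 n)) -> quadratic_signs e1 ->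
  (forall n, chi2 (Z.of_nat n) = RtoC (e2 n)) -> quadratic_signs e2 -> 2 <= fst s ->
  Cmod (fLchi chi1 chi2 s - dpoly (ltrunc e1 e2 N) s)%C <= 3840 / (INR N + 1).
Proof.
move=> H1 S1 H2 S2 s2.
have T (chi : Z -> C) (a : nat -> R) : (forall n, chi (Z.of_nat n) = RtoC (a n)) -> (forall n, Rabs (a n) <= 1) ->
    [/\ Cmod (dirichlet_series chi s) <= 4, Cmod (dpoly (dtrunc a N) s) <= 8 &
        Cmod (dirichlet_series chi s - dpoly (dtrunc a N) s)%C <= 4 / (INR N + 1)].
  move=> h b; have t0 := dirichlet_series_tail chi a 0 s h b s2.
  have tN := dirichlet_series_tail chi a N s h b s2.
  have z : Cmod (dirichlet_series chi s) <= 4.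
    move: t0; rewrite /dtrunc /= Rplus_0_l /Rdiv Rinv_1 Rmult_1_r.
    by rewrite (_ : (_ - 0)%C = dirichlet_series chi s); last ring.
  split=> //; have le : 4 / (INR N + 1) <= 4.
    by have := pos_INR N => N0; apply/Rle_div_l; lra.
  have := Cmod_triangle (dirichlet_series chi s)
    (- (dirichlet_series chi s - dpoly (dtrunc a N) s))%C.
  rewrite Cmod_opp (_ : (_ + - _)%C = dpoly (dtrunc a N) s); last ring.
  lra.
have [a1 a2 a3] := T (fun _ => RtoC 1) (fun _ => 1) (fun _ => erefl) (fun _ => Req_le _ _ Rabs_R1).
have [b1 b2 b3] := T chi1 e1 H1 (fun n => quadratic_signs_bound e1 n S1).
have [c1 c2 c3] := T chi2 e2 H2 (fun n => quadratic_signs_bound e2 n S2).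
have H3 n : character_mul chi1 chi2 (Z.of_nat n) = RtoC (e1 n * e2 n).
  by rewrite /character_mul H1 H2 RtoC_mult.
have B3 n : Rabs (e1 n * e2 n) <= 1.
  rewrite Rabs_mult -[X in _ <= X]Rmult_1_l.
  by apply: Rmult_le_compat; try exact: Rabs_pos; exact: quadratic_signs_bound.
have [d1 d2 d3] := T _ _ H3 B3.
rewrite /ltrunc !dpoly_dmul ?dmul_pos ?dtrunc_pos //.
rewrite /fLchi /zeta /Lfun -Cmult_assoc.
set e := 4 / (INR N + 1) in a3 b3 c3 d3 *.
have e0 : 0 <= e by apply: Rdiv_le_0_compat; have := pos_INR N; lra.
have p1 := Cmod_mult_diff _ _ _ _ _ _ _ _ a1 b2 a3 b3.
have p2 := Cmod_mult_diff _ _ _ _ _ _ _ _ c1 d2 c3 d3.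
have q1 : Cmod (dirichlet_series (fun=> RtoC 1) s * dirichlet_series chi1 s)%C <= 4 * 4.
  by rewrite Cmod_mult; apply: Rmult_le_compat => //; exact: Cmod_ge_0.
have q2 : Cmod (Cmult (dpoly (dtrunc e2 N) s) (dpoly (dtrunc (fun n => e1 n * e2 n) N) s)) <= 8 * 8.
  by rewrite Cmod_mult; apply: Rmult_le_compat => //; exact: Cmod_ge_0.
apply: Rle_trans (Cmod_mult_diff _ _ _ _ _ _ _ _ q1 q2 p1 p2) _.
by rewrite (_ : 3840 / _ = 960 * e); [lra|rewrite /e /Rdiv; ring].
Qed.

(** A term [c n^-(s+w)] shifts the argument of the kernel by [ln n], which turns
    the integral of a Dirichlet polynomial into a [wsum]. *)
Lemma dpoly_kernel (l : seq (R * nat)) (w u t : R) :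
  (dpoly l ((2, t) + RtoC w) * kernel u t)%C =
  (wsum (fun n => exp (- (w * ln (INR n))) * kernel_part line_re (u - ln (INR n)) t) l,
   wsum (fun n => exp (- (w * ln (INR n))) * kernel_part line_im (u - ln (INR n)) t) l).
Proof.
rewrite /wsum; elim: l => [|p l IH]; first by rewrite !big_nil /= Cmult_0_l.
rewrite !big_cons /= Cmult_plus_distr_r IH.
set v := ln (INR p.2).
have E : (Rcpow (INR p.2) (- ((2, t) + RtoC w)) * kernel u t = RtoC (exp (- (w * v))) * kernel (u - v) t)%C.
  have h : (Rcpow (INR p.2) (- ((2, t) + RtoC w)) * Cexp ((2, t) * RtoC u) =
     RtoC (exp (- (w * v))) * Cexp ((2, t) * RtoC (u - v)))%C.
    have -> : RtoC (exp (- (w * v))) = Cexp (RtoC (- (w * v))).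
      by rewrite /Cexp /RtoC /= cos_0 sin_0 Rmult_1_r Rmult_0_r.
    rewrite /Rcpow -/v -!Cexp_plus; congr Cexp.
    by apply: injective_projections; rewrite /Cplus /Cmult /Copp /RtoC /=; ring.
  by rewrite /kernel /Cdiv !Cmult_assoc h.
rewrite -Cmult_assoc E kernel_parts.
by apply: injective_projections; rewrite /Cplus /Cmult /RtoC /=; ring.
Qed.

Lemma ex_RInt_wsum (phi : nat -> R -> R) (l : seq (R * nat)) (x y : R) :
  (forall n, ex_RInt (phi n) x y) -> ex_RInt (fun t => wsum (fun n => phi n t) l) x y.
Proof.
move=> H; rewrite /wsum; elim: l => [|p l IH].
  by apply: (ex_RInt_ext (fun _ => 0)) => [t _|]; [rewrite big_nil|exact: ex_RInt_const].
apply: (ex_RInt_ext (fun t => plus (scal p.1 (phi p.2 t)) (wsum (fun n => phi n t) l))).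
  by move=> t _; rewrite big_cons.
by apply: ex_RInt_plus => //; exact: ex_RInt_scal.
Qed.

Lemma is_RInt_gen_wsum (phi : nat -> R -> R) (J : nat -> R) (l : seq (R * nat)) :
  (forall n, is_RInt_gen (phi n) (Rbar_locally m_infty) (Rbar_locally p_infty) (J n)) ->
  is_RInt_gen (fun t => wsum (fun n => phi n t) l)
    (Rbar_locally m_infty) (Rbar_locally p_infty) (wsum J l).
Proof.
move=> H; rewrite /wsum; elim: l => [|p l IH].
  rewrite big_nil; apply: is_RInt_gen_eps => [a b|e e0].
    by apply: (ex_RInt_ext (fun _ => 0)) => [t _|]; [rewrite big_nil|exact: ex_RInt_const].
  exists 0 => a b _ _; rewrite (RInt_ext _ (fun _ => 0)); last by move=> t _; rewrite big_nil.
  by rewrite RInt_const /scal /= /mult /= Rmult_0_r Rminus_0_r Rabs_R0.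
rewrite big_cons.
apply: (is_RInt_gen_ext (fun t => plus (scal p.1 (phi p.2 t)) (wsum (fun n => phi n t) l))).
  by apply: filter_forall => ab t _; rewrite big_cons.
by apply: is_RInt_gen_plus => //; exact: is_RInt_gen_scal.
Qed.

(** * The integral as a finite sum of nonnegative terms *)

Lemma is_RInt_gen_C (F : R -> C) (a b : R) :
  is_RInt_gen (fun t => fst (F t)) (Rbar_locally m_infty) (Rbar_locally p_infty) a ->
  is_RInt_gen (fun t => snd (F t)) (Rbar_locally m_infty) (Rbar_locally p_infty) b ->
  @is_RInt_gen C_R_NormedModule F (Rbar_locally m_infty) (Rbar_locally p_infty) (a, b).
Proof.
move=> Ha Hb P [e He].
have [|A1 B1 [x1 HA1] [y1 HB1] H1] := Ha (ball a e); first by exists e.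
have [|A2 B2 [x2 HA2] [y2 HB2] H2] := Hb (ball b e); first by exists e.
exists (fun x => A1 x /\ A2 x) (fun x => B1 x /\ B2 x).
- by exists (Rmin x1 x2) => x Hx; split; [apply: HA1|apply: HA2];
    [have := Rmin_l x1 x2|have := Rmin_r x1 x2]; lra.
- by exists (Rmax y1 y2) => x Hx; split; [apply: HB1|apply: HB2];
    [have := Rmax_l y1 y2|have := Rmax_r y1 y2]; lra.
move=> x y [a1 a2] [b1 b2].
have [u [Hu Bu]] := H1 x y a1 b1; have [v [Hv Bv]] := H2 x y a2 b2.
exists (u, v); split; last by apply: He; split.
exact: is_RInt_fct_extend_pair.
Qed.

Theorem lemma4 :
  exists X M : R, 0 < X /\ 0 < M /\
    forall (q1 q2 : Z) (chi1 chi2 : Z -> C),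
      (1 < q1)%Z -> (1 < q2)%Z ->
      primitive_character q1 chi1 -> quadratic_character q1 chi1 ->
      primitive_character q2 chi2 -> quadratic_character q2 chi2 ->
      forall w x : R, 0 < w < 1 -> X <= x ->
        exists (I : C) (J : R),
          is_vertical_integral
            (fun s : C =>
               (fLchi chi1 chi2 (s + RtoC w) *
                 (Rcpow x s / (s * (s + 1) * (s + 2) * (s + 3) * (s + 4))))%C)
            2 I /\
          (/ (2 * RtoC PI * Ci) * I)%C = RtoC J /\
          M <= J.
Proof.
exists 2, (/ 384); split; [lra|split; first lra].
move=> q1 q2 chi1 chi2 _ _ _ Q1 _ Q2 w x [w0 _] x2.
have [R1 S1] := quadratic_values q1 chi1 Q1.
have [R2 S2] := quadratic_values q2 chi2 Q2.
set e1 := fun n => _ in S1; set e2 := fun n => _ in S2.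
pose u := ln x.
pose phi n := exp (- (w * ln (INR n))) * (2 * (PI * riesz_weight (u - ln (INR n)))).
have [N xN] : exists N : nat, x <= INR N by exists (Z.to_nat (up x)); rewrite INR_IZR_INZ Z2Nat.id; [have := archimed x; lra|apply: le_IZR; have := archimed x; lra].
have phi0 m : (N < m)%N -> phi m = 0.
  move=> Nm; have mN : INR N <= INR m by apply: le_INR; apply/leP; exact: ltnW.
  rewrite /phi /riesz_weight; case: Rlt_dec => [h|_] /=; last ring.
  by have := ln_le x (INR m) ltac:(lra) ltac:(lra); rewrite /u in h; lra.
have phi_ge0 n : 0 <= phi n.
  apply: Rmult_le_pos; first by left; exact: exp_pos.
  apply: Rmult_le_pos; first lra; apply: Rmult_le_pos; first by have := PI_RGT_0; lra.
  rewrite /riesz_weight; case: Rlt_dec => _ /=; last lra.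
  apply: Rdiv_le_0_compat; last lra.
  have := pow2_ge_0 ((1 - exp (- (u - ln (INR n)))) ^ 2); rewrite -pow_mult; exact.
(* [Jt / (2 pi)] is the sum of [a(n) n^-w (1 - n/x)^4 / 24] over [n < x]. *)
pose Jt := wsum phi (dtrunc (lcoef e1 e2) N).
have N0 : (0 < N)%N by apply/ltP/INR_lt; rewrite /=; lra.
have JN n : (N <= n)%N -> wsum phi (ltrunc e1 e2 n) = Jt by exact: wsum_ltrunc.
pose eps n := 3840 / (INR n + 1) * exp (2 * u).
have eps_lim : is_lim_seq eps 0.
  have := is_lim_seq_scal_l _ (exp (2 * u)) _ (is_lim_seq_div_S 3840); rewrite /= Rmult_0_r.
  by apply: is_lim_seq_ext => n; rewrite /eps Rmult_comm.
pose F t := (fLchi chi1 chi2 ((2, t) + RtoC w) * kernel u t)%C.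
pose G n t := (dpoly (ltrunc e1 e2 n) ((2, t) + RtoC w) * kernel u t)%C.
have FG n t : Cmod (F t - G n t)%C <= eps n / (1 + t ^ 2).
  rewrite (_ : (F t - G n t)%C =
    ((fLchi chi1 chi2 ((2, t) + RtoC w) - dpoly (ltrunc e1 e2 n) ((2, t) + RtoC w)) * kernel u t)%C); last by rewrite /F /G; ring.
  rewrite Cmod_mult /eps /Rdiv Rmult_assoc.
  apply: Rmult_le_compat; try exact: Cmod_ge_0; last exact: Cmod_kernel.
  by apply: fLchi_truncation => //=; lra.
have Fre : is_RInt_gen (fun t => fst (F t)) (Rbar_locally m_infty) (Rbar_locally p_infty) Jt.
  apply: (is_RInt_gen_dominated _ (fun n t => fst (G n t)) eps _ N) => // [n a b|n t|n Hn].
  - apply: (ex_RInt_ext (fun t => wsum (fun m => exp (- (w * ln (INR m))) *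
        kernel_part line_re (u - ln (INR m)) t) (ltrunc e1 e2 n))) => [t _|]; first by rewrite /G dpoly_kernel.
    apply: ex_RInt_wsum => m; apply: (@ex_RInt_scal R_NormedModule); apply: ex_RInt_kernel_part => c c0.
    exact: ex_RInt_line_re.
  - exact: Rle_trans (Rabs_fst_le_Cmod _) (FG n t).
  - rewrite -(JN n) //.
    apply: (is_RInt_gen_ext (fun t => wsum (fun m => exp (- (w * ln (INR m))) *
        kernel_part line_re (u - ln (INR m)) t) (ltrunc e1 e2 n))).
      by apply: filter_forall => ab t _; rewrite /G dpoly_kernel.
    apply: (is_RInt_gen_wsum (fun m t => exp (- (w * ln (INR m))) * kernel_part line_re (u - ln (INR m)) t)) => m.
    by apply: (@is_RInt_gen_scal R_NormedModule); exact: is_RInt_gen_kernel_re.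
have Fim : is_RInt_gen (fun t => snd (F t)) (Rbar_locally m_infty) (Rbar_locally p_infty) 0.
  apply: (is_RInt_gen_dominated _ (fun n t => snd (G n t)) eps _ 0) => // [n a b|n t|n Hn].
  - apply: (ex_RInt_ext (fun t => wsum (fun m => exp (- (w * ln (INR m))) *
        kernel_part line_im (u - ln (INR m)) t) (ltrunc e1 e2 n))) => [t _|]; first by rewrite /G dpoly_kernel.
    apply: ex_RInt_wsum => m; apply: (@ex_RInt_scal R_NormedModule); apply: ex_RInt_kernel_part => c c0.
    exact: ex_RInt_line_im.
  - exact: Rle_trans (Rabs_snd_le_Cmod _) (FG n t).
  - have -> : 0 = wsum (fun m => exp (- (w * ln (INR m))) * 0) (ltrunc e1 e2 n).
      by rewrite /wsum big1 // => p _; rewrite !Rmult_0_r.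
    apply: (is_RInt_gen_ext (fun t => wsum (fun m => exp (- (w * ln (INR m))) *
        kernel_part line_im (u - ln (INR m)) t) (ltrunc e1 e2 n))).
      by apply: filter_forall => ab t _; rewrite /G dpoly_kernel.
    apply: (is_RInt_gen_wsum (fun m t => exp (- (w * ln (INR m))) * kernel_part line_im (u - ln (INR m)) t)) => m.
    by apply: (@is_RInt_gen_scal R_NormedModule); exact: is_RInt_gen_kernel_im.
exists (Ci * RtoC Jt)%C, (Jt / (2 * PI)); split; last split.
- exists (RtoC Jt); split => //; exact: (is_RInt_gen_C F Jt 0).
- have P := PI_RGT_0; have Pn : RtoC PI <> 0%C by apply: Re_pos_neq_0.
  have n2 : RtoC 2 <> 0%C by apply: Re_pos_neq_0 => /=; lra.
  have nI : Ci <> 0%C by move/(congr1 snd) => /=; lra.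
  have -> : RtoC (Jt / (2 * PI)) = (RtoC Jt / (RtoC 2 * RtoC PI))%C.
    by rewrite -RtoC_mult -RtoC_div //; lra.
  by field; do ?split.
- have P := PI_RGT_0.
  have h := wsum_lcoef_ge e1 e2 phi N S1 S2 (fun n _ => phi_ge0 n) N0.
  have x0 : 0 < x by lra.
  have E : phi 1%N = 2 * PI * ((1 - / x) ^ 4 / 24).
    rewrite /phi [INR 1]/1 ln_1 Rmult_0_r Ropp_0 exp_0 Rminus_0_r /riesz_weight.
    case: Rlt_dec => [_|] /=; last by have := ln_increasing 1 x; rewrite ln_1 /u; lra.
    by rewrite exp_Ropp /u exp_ln //; field; lra.
  have ix : / x <= / 2 by apply: Rinv_le_contravar; lra.
  have p4 : (/ 2) ^ 4 <= (1 - / x) ^ 4 by apply: pow_incr; lra.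
  apply/Rle_div_r; first lra.
  have : 2 * PI * ((/ 2) ^ 4 / 24) <= phi 1%N.
    by rewrite E; apply: Rmult_le_compat_l; lra.
  rewrite -/Jt in h; lra.
Qed.
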